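(* Let $X$ be a compact Polish space and let $X^\#=(X,d,(p_n)_{n\in\mathbb{N}})$ be a computably compact presentation of $X$. Then there is a computable presentation $C^*(X)^\#$ of $C^*(X)$ such that: (1) $\widehat{p_n}$ is a computable functional of $C^*(X)^\#$ uniformly in $n$; and (2) $\vec{d}_{p_n}$ is a computable vector of $C^*(X)^\#$ uniformly in $n$.
   Context: For a compact Polish space $X$, $C^*(X)$ is the commutative unital $C^*$-algebra of continuous functions $X\to\mathbb{C}$ with the sup norm, pointwise operations and complex conjugation as involution. For $p\in X$, $\widehat{p}:C^*(X)\to\mathbb{C}$ is $f\mapsto f(p)$, and $\vec{d}_p\in C^*(X)$ is $q\mapsto d(p,q)$. A presentation of a metric space $(M,d)$ is $M^\#=(M,(s_n)_{n\in\mathbb{N}})$ with $(s_n)$ dense (distinguished points); a presentation of $X$ is $X^\#=(X,d,(p_n))$ with $d$ a compatible metric. $M^\#$ is computable if $d(s_j,s_k)$ is computable uniformly in $j,k$. A name of $x$ is a sequence $(n_k)$ with $d(s_{n_k},x)<2^{-k}$; $x$ is a computable point if it has a computable name (uniformly in $n$ for a sequence: names computable uniformly in $n$); a map between presented spaces is computable if some oracle Turing machine transforms every name of any input into a name of its image (uniformly in $n$ for a sequence of maps); $\mathbb{C}$ has its standard presentation. A total boundedness function of $M^\#$ is $f:\mathbb{N}\to\mathbb{N}$ such that $f(j)$ codes a finite $F\subseteq\mathbb{N}$ with $M=\bigcup_{k\in F}B(s_k;2^{-j})$; $M^\#$ is computably compact if it is computable and has a computable total boundedness function. Fix an effective enumeration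 $(\mathfrak{p}_n)$ of the $*$-polynomials with coefficients in $\mathbb{Q}(i)$ in variables $x_0,x_1,\dots$. A presentation of a $C^*$-algebra $A$ is $A^\#=(A,(u_n))$ such that the rational vectors $\mathfrak{p}_n[A^\#]$ (substitute $u_j$ for $x_j$) are dense in $A$; it is computable if $\|\mathfrak{p}_n[A^\#]\|$ is computable uniformly in $n$. It is regarded as a presented metric space with the rational vectors as distinguished points, so computable vectors are the computable points of this space, and a computable functional of $A^\#$ is a computable map from $A^\#$ to $\mathbb{C}$. *)

(* Defs.v *)
From HB Require Import structures.
From mathcomp Require Import all_boot all_order all_algebra.
From mathcomp Require Import all_classical all_reals all_analysis.
From mathcomp Require Import complex.

Set Implicit Arguments.
Unset Strict Implicit.
Unset Printing Implicit Defensive.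

Import Order.TTheory GRing.Theory Num.Theory.
Import numFieldNormedType.Exports.

Local Open Scope classical_set_scope.
Local Open Scope ring_scope.

(* Computability: Kleene's mu-recursive functionals, i.e. the partial functions
   on tuples of naturals computed by oracle Turing machines.  Tuples are lists;
   reading a missing entry gives 0. *)
Inductive prog : Type :=
  | PZero
  | PSucc
  | PProj of nat
  | POracle
  | PComp of prog & seq prog
  | PRec of prog & prog
  | PMu of prog.

(* [runs O e v y]: with oracle O, program e halts on input v with output y. *)
Inductive runs (O : nat -> nat) : prog -> seq nat -> nat -> Prop :=
  | runs_zero v : runs O PZero v 0%N
  | runs_succ v : runs O PSucc v (nth 0%N v 0).+1
  | runs_proj i v : runs O (PProj i) v (nth 0%N v i)
  | runs_oracle v : runs O POracle v (O (nth 0%N v 0))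
  | runs_comp f gs v ws y :
      runs_all O gs v ws -> runs O f ws y -> runs O (PComp f gs) v y
  | runs_rec0 f g v y : runs O f v y -> runs O (PRec f g) (0%N :: v) y
  | runs_recS f g n v z y :
      runs O (PRec f g) (n :: v) z -> runs O g [:: n, z & v] y ->
      runs O (PRec f g) (n.+1 :: v) y
  | runs_mu f v n (w : nat -> nat) :
      (forall m, (m < n)%N -> runs O f (m :: v) (w m).+1) ->
      runs O f (n :: v) 0%N -> runs O (PMu f) v n
with runs_all (O : nat -> nat) : seq prog -> seq nat -> seq nat -> Prop :=
  | runs_nil v : runs_all O [::] v [::]
  | runs_cons g gs v w ws :
      runs O g v w -> runs_all O gs v ws ->
      runs_all O (g :: gs) v (w :: ws).

(* The zero oracle is computable, so it adds nothing. *)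
Definition no_oracle : nat -> nat := fun=> 0%N.

Definition computable_fun (f : nat -> nat) :=
  exists e, forall n, runs no_oracle e [:: n] (f n).

(* The finite set of naturals with canonical index c: the set of the positions
   of the digits 1 in the binary expansion of c. *)
Definition coded_set (c : nat) : set nat := [set k | odd (c %/ 2 ^ k)%N].

(* Only the data: neither the metric axioms nor the density of the
   distinguished points is part of the record. *)
Record presented_metric (R : realType) := PresentedMetric {
  pm_sort :> Type;
  pm_dist : pm_sort -> pm_sort -> R;
  pm_pt : nat -> pm_sort }.

Section computable_metric.
Context {R : realType}.
Implicit Types M N : presented_metric R.

Definition is_name M (x : M) (nu : nat -> nat) :=
  forall k, pm_dist (pm_pt M (nu k)) x < 2 ^- k.

(* On input args, k and with oracle O, the program e outputs the k-th term of
   a name of x. *)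
Definition computes_name (O : nat -> nat) (e : prog) (args : seq nat)
    M (x : M) :=
  exists2 nu, is_name x nu & forall k, runs O e (rcons args k) (nu k).

Definition computable_points M (x : nat -> M) :=
  exists e, forall n, computes_name no_oracle e [:: n] (x n).

Definition computable_points2 M (x : nat -> nat -> M) :=
  exists e, forall j k, computes_name no_oracle e [:: j; k] (x j k).

Definition computable_maps M N (F : nat -> M -> N) :=
  exists e, forall n (x : M) nu, is_name x nu ->
    computes_name nu e [:: n] (F n x).

End computable_metric.

(* Effective enumerations, via the bijection CodeSeq.decode : nat -> seq nat. *)
Definition rat_of_code (n : nat) : rat :=
  let s := CodeSeq.decode n in
  ((nth 0%N s 0)%:R - (nth 0%N s 1)%:R) / (nth 0%N s 2).+1%:R.

Definition gauss_of_code (n : nat) : rat[i] :=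
  let s := CodeSeq.decode n in
  Complex (rat_of_code (nth 0%N s 0)) (rat_of_code (nth 0%N s 1)).

(* A *-polynomial is a list of terms c * w, where c is in Q(i) and the word w
   lists its letters: (j, false) is x_j and (j, true) is x_j^*. *)
Definition starpoly := seq (rat[i] * seq (nat * bool)).

Definition letter_of_code (n : nat) : nat * bool := (n./2, odd n).

Definition term_of_code (n : nat) : rat[i] * seq (nat * bool) :=
  let s := CodeSeq.decode n in
  (gauss_of_code (head 0%N s), map letter_of_code (behead s)).

Definition starpoly_of_code (n : nat) : starpoly :=
  map term_of_code (CodeSeq.decode n).

Lemma rat_of_code_surj (q : rat) : exists n, rat_of_code n = q.
Proof.
have [d dE] : exists d, denq q = d.+1%:Z.
  by case: (denq q) (denq_gt0 q) => [[|d]|d] // _; exists d.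
have [[a b] abE] : exists ab : nat * nat, numq q = ab.1%:Z - ab.2%:Z.
  case: (numq q) => n; first by exists (n, 0%N); rewrite subr0.
  by exists (0%N, n.+1); rewrite NegzE sub0r.
exists (CodeSeq.code [:: a; b; d]).
by rewrite /rat_of_code CodeSeq.codeK -[RHS]divq_num_den abE dE rmorphB.
Qed.

Lemma gauss_of_code_surj (c : rat[i]) : exists n, gauss_of_code n = c.
Proof.
case: c => a b; have [m <-] := rat_of_code_surj a.
have [n <-] := rat_of_code_surj b.
by exists (CodeSeq.code [:: m; n]); rewrite /gauss_of_code CodeSeq.codeK.
Qed.

Lemma starpoly_of_code_surj (P : starpoly) : exists n, starpoly_of_code n = P.
Proof.
suff [s <-] : exists s, map term_of_code s = P.
  by exists (CodeSeq.code s); rewrite /starpoly_of_code CodeSeq.codeK.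
elim: P => [|[c w] P [s <-]]; first by exists [::].
have [k <-] := gauss_of_code_surj c.
exists (CodeSeq.code (k :: map (fun l : nat * bool => (l.2 + l.1.*2)%N) w) :: s).
rewrite map_cons {1}/term_of_code CodeSeq.codeK [behead _]/= [head _ _]/=.
rewrite -map_comp; congr ((_, _) :: _).
rewrite -[RHS]map_id; apply: eq_map => -[j b].
by rewrite /letter_of_code /= half_bit_double oddD odd_double addbF oddb.
Qed.

Section standard_presentations.
Context {R : realType}.

Definition gaussr (c : rat[i]) : R[i] :=
  Complex (ratr (complex.Re c)) (ratr (complex.Im c)).

Definition cdist (z w : R[i]) : R := complex.Re `|z - w|.

Definition real_line : presented_metric R :=
  PresentedMetric (fun x y : R => `|x - y|) (fun n => ratr (rat_of_code n)).

Definition complex_plane : presented_metric R :=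
  PresentedMetric cdist (fun n => gaussr (gauss_of_code n)).

End standard_presentations.

Lemma real_line_dense (R : realType) (x e : R) : 0 < e ->
  exists n, pm_dist (pm_pt (@real_line R) n) x < e.
Proof.
move=> e0; have [q] : exists q : rat, ratr q \in `]x, x + e[.
  by apply: rat_in_itvoo; rewrite ltrDl.
have [n <-] := rat_of_code_surj q; rewrite in_itv /= => /andP[xq qe].
by exists n; rewrite /= gtr0_norm ?subr_gt0 // ltrBlDl.
Qed.

Lemma complex_plane_dense (R : realType) (z : R[i]) (e : R) : 0 < e ->
  exists n, pm_dist (pm_pt (@complex_plane R) n) z < e.
Proof.
case: z => a b e0; have e20 : 0 < e / 2 by rewrite divr_gt0.
have [m /= hm] := real_line_dense a e20.
have [n /= hn] := real_line_dense b e20.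
exists (CodeSeq.code [:: m; n]).
change (cdist (gaussr (gauss_of_code (CodeSeq.code [:: m; n])))
              (Complex a b) < e).
rewrite /gauss_of_code CodeSeq.codeK /cdist /gaussr [nth _ _ 0]/= [nth _ _ 1]/=.
set r := ratr _ in hm *; set s := ratr _ in hn *.
rewrite normc_def /= -/(r - a) -/(s - b) (splitr e).
apply: le_lt_trans (ltrD hm hn); set x := r - a; set y := s - b.
rewrite -[leRHS]ger0_norm ?addr_ge0// -sqrtr_sqr ler_sqrt ?sqr_ge0//.
rewrite [leRHS]sqrrD !real_normK ?num_real// addrAC lerDl.
by rewrite mulrn_wge0 // mulr_ge0.
Qed.

Section computably_compact.
Context {R : realType}.
Implicit Types M : presented_metric R.

Definition computable_metric M :=
  computable_points2 (M := real_line)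
    (fun j k => pm_dist (pm_pt M j) (pm_pt M k)).

Definition total_boundedness_function M (f : nat -> nat) :=
  forall j, [set: M] =
    \bigcup_(k in coded_set (f j)) [set x | pm_dist (pm_pt M k) x < 2 ^- j].

Definition computably_compact M :=
  computable_metric M /\
  exists2 f, computable_fun f & total_boundedness_function M f.

End computably_compact.

Section polish.
Context {R : realType} {X : topologicalType}.

Definition is_metric (d : X -> X -> R) :=
  [/\ forall x y, 0 <= d x y,
      forall x y, d x y = 0 <-> x = y,
      forall x y, d x y = d y x &
      forall x y z, d x z <= d x y + d y z].

Definition compatible_metric (d : X -> X -> R) :=
  is_metric d /\
  forall x A, nbhs x A <-> exists2 e, 0 < e & [set y | d x y < e] `<=` A.

Definition complete_metric (d : X -> X -> R) :=
  forall u : nat -> X,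
    (forall e : R, 0 < e -> exists n0, forall m n,
      (n0 <= m)%N -> (n0 <= n)%N -> d (u m) (u n) < e) ->
    exists l : X, u @ \oo --> l.

End polish.

Definition polish (R : realType) (X : topologicalType) :=
  (exists2 d : X -> X -> R, compatible_metric d & complete_metric d) /\
  (exists2 S : set X, countable S & dense S).

Record polish_presentation (R : realType) (X : topologicalType) :=
  PolishPresentation {
    pp_dist : X -> X -> R;
    pp_compatible : compatible_metric pp_dist;
    pp_pt : nat -> X;
    pp_dense : dense (range pp_pt) }.

Definition polish_presented (R : realType) (X : topologicalType)
    (P : polish_presentation R X) : presented_metric R :=
  PresentedMetric (pp_dist P) (pp_pt P).

Coercion polish_presented : polish_presentation >-> presented_metric.

(* C*(X): the continuous functions X -> C with the pointwise operations. *)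
Definition CX (R : realType) (X : topologicalType) : Type :=
  continuousType X (R[i])^o.

Section CX_algebra.
Context {R : realType} {X : topologicalType}.
Implicit Types f g : CX R X.

HB.instance Definition _ := Choice.on (CX R X).

Lemma CX_eq f g : f =1 g -> f = g.
Proof. by move=> fg; apply/continuousEP. Qed.

Definition CX_cst (c : R[i]) : CX R X :=
  mkcts (f := fun _ : X => c : (R[i])^o) (fun x => cvg_cst _).

Fact CX_add_cts f g : continuous (fun x => f x + g x).
Proof. by move=> x; apply: cvgD; exact: cts_fun. Qed.
Definition CX_add f g : CX R X := mkcts (@CX_add_cts f g).

Fact CX_opp_cts f : continuous (fun x => - f x).
Proof. by move=> x; apply: cvgN; exact: cts_fun. Qed.
Definition CX_opp f : CX R X := mkcts (@CX_opp_cts f).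

Fact CX_mul_cts f g : continuous (fun x => f x * g x).
Proof. by move=> x; apply: cvgM; exact: cts_fun. Qed.
Definition CX_mul f g : CX R X := mkcts (@CX_mul_cts f g).

Fact CX_star_cts f : continuous (fun x => (conjc (f x) : (R[i])^o)).
Proof.
move=> x; apply/cvgrPdist_lt => e e0.
have /cvgrPdist_lt/(_ e e0) := @cts_fun _ _ f x.
by apply: filterS => y; rewrite -rmorphB normcJ.
Qed.
Definition CX_star f : CX R X := mkcts (@CX_star_cts f).

Fact CX_addA : associative CX_add.
Proof. by move=> f g h; apply: CX_eq => x; exact: addrA. Qed.
Fact CX_addC : commutative CX_add.
Proof. by move=> f g; apply: CX_eq => x; exact: addrC. Qed.
Fact CX_add0 : left_id (CX_cst 0) CX_add.
Proof. by move=> f; apply: CX_eq => x; exact: add0r. Qed.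
Fact CX_addN : left_inverse (CX_cst 0) CX_opp CX_add.
Proof. by move=> f; apply: CX_eq => x; exact: addNr. Qed.

HB.instance Definition _ :=
  GRing.isZmodule.Build (CX R X) CX_addA CX_addC CX_add0 CX_addN.

Fact CX_mulA : associative CX_mul.
Proof. by move=> f g h; apply: CX_eq => x; exact: mulrA. Qed.
Fact CX_mulC : commutative CX_mul.
Proof. by move=> f g; apply: CX_eq => x; exact: mulrC. Qed.
Fact CX_mul1 : left_id (CX_cst 1) CX_mul.
Proof. by move=> f; apply: CX_eq => x; exact: mul1r. Qed.
Fact CX_mulDl : left_distributive CX_mul CX_add.
Proof. by move=> f g h; apply: CX_eq => x; exact: mulrDl. Qed.

HB.instance Definition _ :=
  GRing.Zmodule_isComPzRing.Build (CX R X) CX_mulA CX_mulC CX_mul1 CX_mulDl.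

Definition CX_scale (c : R[i]) f : CX R X := CX_cst c * f.

Fact CX_scaleA a b f : CX_scale a (CX_scale b f) = CX_scale (a * b) f.
Proof. by apply: CX_eq => x; exact: mulrA. Qed.
Fact CX_scale1 : left_id 1 CX_scale.
Proof. by move=> f; apply: CX_eq => x; exact: mul1r. Qed.
Fact CX_scaleDr : right_distributive CX_scale +%R.
Proof. by move=> a f g; apply: CX_eq => x; exact: mulrDr. Qed.
Fact CX_scaleDl f : {morph CX_scale^~ f : a b / a + b}.
Proof. by move=> a b; apply: CX_eq => x; exact: mulrDl. Qed.

HB.instance Definition _ := GRing.Zmodule_isLmodule.Build R[i] (CX R X)
  CX_scaleA CX_scale1 CX_scaleDr CX_scaleDl.

Definition supnorm f : R := sup (range (fun x => complex.Re `|f x|)).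

(* The element of C*(X) obtained from P by substituting u_j for x_j. *)
Definition starpoly_eval (u : nat -> CX R X) (P : starpoly) : CX R X :=
  \sum_(t <- P)
    gaussr t.1 *: \prod_(l <- t.2) (if l.2 then CX_star (u l.1) else u l.1).

Lemma starpoly_evalE (u : nat -> CX R X) P x :
  starpoly_eval u P x = \sum_(t <- P) gaussr t.1 *
    \prod_(l <- t.2) (if l.2 then conjc (u l.1 x) else u l.1 x).
Proof.
elim: P => [|[c w] P IH]; first by rewrite /starpoly_eval !big_nil.
rewrite big_cons -IH /starpoly_eval big_cons /=; congr (_ * _ + _).
by elim: w => [|[j b] w IHw]; rewrite ?big_nil ?big_cons -?IHw //=; case: b.
Qed.

Definition rational_vector (u : nat -> CX R X) (n : nat) : CX R X :=
  starpoly_eval u (starpoly_of_code n).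

End CX_algebra.

Record CX_presentation (R : realType) (X : topologicalType) := CXPresentation {
  cx_gen : nat -> CX R X;
  cx_dense : forall (f : CX R X) (e : R), 0 < e ->
    exists n, supnorm (rational_vector cx_gen n - f) < e }.

Definition CX_presented (R : realType) (X : topologicalType)
    (A : CX_presentation R X) : presented_metric R :=
  PresentedMetric (fun f g : CX R X => supnorm (f - g))
    (rational_vector (cx_gen A)).

Coercion CX_presented : CX_presentation >-> presented_metric.

Section main_notions.
Context {R : realType} {X : topologicalType}.

Definition computable_CX_presentation (A : CX_presentation R X) :=
  computable_points (M := real_line)
    (fun n => supnorm (rational_vector (cx_gen A) n)).

(* The evaluation functional at p. *)
Definition hat (p : X) (f : CX R X) : R[i] := f p.

Variable P : polish_presentation R X.

Fact dist_fun_cts (p : X) :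
  continuous (fun q => (Complex (pp_dist P p q) 0 : (R[i])^o)).
Proof.
case: (pp_compatible P) => -[_ _ dC dT] nb x; apply/cvgrPdist_lt => e e0.
have [e1 e2] : 0 < complex.Re e /\ complex.Im e = 0.
  by move: e0; case: e => a b; rewrite ltcE /= => /andP[/eqP ->].
apply/nb; exists (complex.Re e) => // y /= xy.
rewrite /GRing.opp /= /GRing.add /= normc_def /= subr0 expr0n addr0 sqrtr_sqr.
rewrite ltcE /= e2 eqxx /= (le_lt_trans _ xy) // ler_norml lerNl opprB.
by rewrite !lerBlDl dT (dC x y) dT.
Qed.

(* The element q |-> d(p, q) of C*(X). *)
Definition dist_fun (p : X) : CX R X := mkcts (@dist_fun_cts p).

End main_notions.

(* Main.v *)
Require Import Defs.
From mathcomp Require Import all_boot all_order all_algebra.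
From mathcomp Require Import all_classical all_reals all_analysis.
From mathcomp Require Import complex.
From mathcomp Require Import zify ring lra.

(* C*(X) is generated by the finite infima
   u_s = min(1, min_i (a_i + d(p_(k_i), .) / B')), where B' bounds d and s codes
   the list of the pairs (k_i, a_i) with a_i a nonnegative rational.  By
   inf-convolution, every continuous real function is a uniform limit of the
   functions K u_s - M, so no Stone-Weierstrass theorem is needed, and
   d(p_n, .) = B' u_s exactly for s = [(n, 0)].  Every u_s is 1-Lipschitz with
   values in [0, 1], so if w(P) bounds the sum over the terms of P of
   |coefficient| * length, an error e on the values of the u_s changes the value
   of the *-polynomial P by at most w(P) e.  This gives both a computable
   Lipschitz constant of P, hence its sup norm from its values on a finite net,
   and the precision needed to evaluate P at p_m from approximate distances. *)

Set Implicit Arguments.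
Unset Strict Implicit.
Unset Printing Implicit Defensive.

Import Order.TTheory GRing.Theory Num.Theory.
Import numFieldNormedType.Exports.

(** * Computable functions of a fixed number of arguments *)

(* The arity is fixed because a program can only rebuild an input of known
   length; independence of O lets the same program run with any oracle. *)
Definition effective (m : nat) (F : seq nat -> nat) :=
  exists e, forall O v, size v = m -> runs O e v (F v).

Fixpoint effectives (m : nat) (gs : seq (seq nat -> nat)) : Prop :=
  if gs is g :: gs' then effective m g /\ effectives m gs' else True.

Lemma eff_ext m F G : effective m F -> (forall v, size v = m -> F v = G v) ->
  effective m G.
Proof. by case=> e he FG; exists e => O v vm; rewrite -FG //; exact: he. Qed.

Lemma eff_comp n m f gs : effective n f -> size gs = n -> effectives m gs ->
  effective m (fun v => f [seq g v | g <- gs]).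
Proof.
case=> e he gsn gsm.
have [es hes] : exists es, forall O v, size v = m ->
    runs_all O es v [seq g v | g <- gs].
  elim: gs {gsn} gsm => [_|g gs IH /= [[eg heg] /IH[es hes]]].
    by exists [::] => O v _; exact: runs_nil.
  by exists (eg :: es) => O v vm; apply: runs_cons; [exact: heg|exact: hes].
exists (PComp e es) => O v vm; apply: runs_comp (hes O v vm) _.
by apply: he; rewrite size_map.
Qed.

Lemma eff_nth m i : effective m (fun v => nth 0 v i).
Proof. by exists (PProj i) => O v _; exact: runs_proj. Qed.

Lemma effectives_nth m k n :
  effectives m (mkseq (fun i v => nth 0 v (k i)) n).
Proof.
by rewrite /mkseq; elim: (iota 0 n) => //= i s IH; split; first exact: eff_nth.
Qed.

Lemma eff_behead m f : effective m f -> effective m.+1 (fun v => f (behead v)).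
Proof.
move=> hf; have h := eff_comp hf (size_mkseq _ m) (effectives_nth m.+1 succn m).
apply: eff_ext h _ => -[|x v] //= [vm]; congr f.
by rewrite -map_comp -[RHS](mkseq_nth 0) vm.
Qed.

Lemma eff_behead2 m f :
  effective m f -> effective m.+2 (fun v => f (behead (behead v))).
Proof. by move=> /eff_behead/eff_behead. Qed.

Lemma eff_skip m f : effective m.+1 f ->
  effective m.+2 (fun v => f (nth 0 v 0 :: behead (behead v))).
Proof.
move=> hf; pose k i := if i is j.+1 then j.+2 else 0.
have h := eff_comp hf (size_mkseq _ m.+1) (effectives_nth m.+2 k m.+1).
apply: eff_ext h _ => -[|x [|y v]] //= [vm]; congr (f (_ :: _)).
rewrite -[v in RHS](mkseq_nth 0) vm /mkseq (iotaDl 1) -!map_comp.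
exact: eq_map.
Qed.

Lemma eff_succ m a : effective m a -> effective m (fun v => (a v).+1).
Proof.
case=> e he; exists (PComp PSucc [:: e]) => O v vm.
apply: (@runs_comp _ _ _ _ [:: a v]); last exact: (runs_succ O [:: a v]).
by apply: runs_cons (runs_nil _ _); exact: he.
Qed.

Lemma eff_const m c : effective m (fun=> c).
Proof.
elim: c => [|c IH]; last exact: eff_succ.
by exists PZero => O v _; exact: runs_zero.
Qed.

Lemma eff_rec m f (g : nat -> nat -> seq nat -> nat) n :
  effective m f ->
  effective m.+2 (fun w => g (nth 0 w 0) (nth 0 w 1) (behead (behead w))) ->
  effective m n ->
  effective m (fun v => nat_rect (fun=> nat) (f v) (fun i z => g i z v) (n v)).
Proof.
move=> [ef hf] [eg hg] hn.
pose h w := nat_rect (fun=> nat) (f (behead w))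
  (fun i z => g i z (behead w)) (head 0 w).
have hh : effective m.+1 h.
  exists (PRec ef eg) => O [|k v] //= [vm]; rewrite /h /=.
  elim: k => [|k IH] /=; first by apply: runs_rec0; exact: hf.
  apply: runs_recS IH _.
  by have := hg O [:: k, nat_rect (fun=> nat) (f v) (fun i z => g i z v) k & v];
    apply; rewrite /= vm.
pose gs := n :: mkseq (fun i v => nth 0 v (id i)) m.
have gsm : size gs = m.+1 by rewrite /= size_mkseq.
have := eff_comp hh gsm (conj hn (effectives_nth m id m)).
move=> /eff_ext; apply => v vm; rewrite /h /= -map_comp.
have vE : [seq nth 0 v i | i <- iota 0 m] = v by rewrite -vm; exact: mkseq_nth.
by rewrite (_ : map _ (iota 0 m) = v).
Qed.

Lemma eff_add m a b : effective m a -> effective m b ->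
  effective m (fun v => a v + b v).
Proof.
move=> ha hb; apply: eff_ext (eff_rec (g := fun _ z _ => z.+1) ha _ hb) _.
  exact/eff_succ/eff_nth.
by move=> v _; elim: (b v) => [|n /= ->]; rewrite ?addn0 ?addnS.
Qed.

Lemma eff_mul m a b : effective m a -> effective m b ->
  effective m (fun v => a v * b v).
Proof.
move=> ha hb.
apply: eff_ext (eff_rec (g := fun _ z v => z + a v) (eff_const m 0) _ hb) _.
  by apply: eff_add; [exact: eff_nth|exact: eff_behead2].
by move=> v _; elim: (b v) => [|n /= ->]; rewrite ?muln0 ?mulnS // addnC.
Qed.

Lemma eff_pred m a : effective m a -> effective m (fun v => (a v).-1).
Proof.
move=> ha.
apply: eff_ext (eff_rec (g := fun i _ _ => i) (eff_const m 0) _ ha) _.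
  exact: eff_nth.
by move=> v _; case: (a v).
Qed.

Lemma eff_sub m a b : effective m a -> effective m b ->
  effective m (fun v => a v - b v).
Proof.
move=> ha hb; apply: eff_ext (eff_rec (g := fun _ z _ => z.-1) ha _ hb) _.
  exact/eff_pred/eff_nth.
by move=> v _; elim: (b v) => [|n /= ->]; rewrite ?subn0 ?subnS.
Qed.

Lemma eff_leq m a b : effective m a -> effective m b ->
  effective m (fun v => (a v <= b v) : nat).
Proof.
move=> ha hb; apply: eff_ext (eff_sub (eff_const m 1) (eff_sub ha hb)) _.
by move=> v _; rewrite -subn_eq0; case: (a v - b v).
Qed.

Lemma eff_if m (c : seq nat -> bool) a b :
  effective m (fun v => c v : nat) -> effective m a -> effective m b ->
  effective m (fun v => if c v then a v else b v).
Proof.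
move=> hc ha hb; apply: eff_ext (eff_add (eff_mul hc ha)
  (eff_mul (eff_sub (eff_const m 1) hc) hb)) _.
by move=> v _; case: (c v); rewrite !(mul1n, mul0n, addn0).
Qed.

Lemma eff_big (idx : nat) (op : Monoid.law idx) m F n :
  (forall k a b, effective k a -> effective k b ->
    effective k (fun v => op (a v) (b v))) ->
  effective m.+1 (fun w => F (nth 0 w 0) (behead w)) -> effective m n ->
  effective m (fun v => \big[op/idx]_(i < n v) F i v).
Proof.
move=> hop hF hn.
apply: eff_ext (eff_rec (g := fun i z v => op z (F i v)) (eff_const m idx) _ hn) _.
  by apply: hop; [exact: eff_nth|exact: (eff_skip hF)].
move=> v _; elim: (n v) => [|k /= ->]; first by rewrite big_ord0.
by rewrite big_ord_recr.
Qed.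

Lemma eff_sum m F n :
  effective m.+1 (fun w => F (nth 0 w 0) (behead w)) -> effective m n ->
  effective m (fun v => \sum_(i < n v) F i v).
Proof. exact: (eff_big eff_add). Qed.

Lemma eff_prod m F n :
  effective m.+1 (fun w => F (nth 0 w 0) (behead w)) -> effective m n ->
  effective m (fun v => \prod_(i < n v) F i v).
Proof. exact: (eff_big eff_mul). Qed.

Lemma eff_max m F n :
  effective m.+1 (fun w => F (nth 0 w 0) (behead w)) -> effective m n ->
  effective m (fun v => \max_(i < n v) F i v).
Proof.
apply: eff_big => k a b ha hb; apply: eff_ext (eff_add ha (eff_sub hb ha)) _.
by move=> v _; rewrite -maxnE.
Qed.

Lemma eff_exp m a b : effective m a -> effective m b ->
  effective m (fun v => a v ^ b v).
Proof.
move=> ha hb; apply: eff_ext (eff_prod (F := fun _ v => a v) _ hb) _.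
  exact: eff_behead.
by move=> v _; rewrite prod_nat_const card_ord.
Qed.

Lemma count_ltn (N q : nat) : q <= N -> \sum_(i < N) (i < q : nat) = q.
Proof.
move=> qN; rewrite -big_mkcond /= (big_ord_narrow qN).
by rewrite sum1_card card_ord.
Qed.

Lemma eff_div m a b : effective m a -> effective m b ->
  effective m (fun v => a v %/ b v).
Proof.
move=> ha hb.
have h0 : effective m (fun v => (b v <= 0) : nat).
  exact: (eff_leq hb (eff_const m 0)).
have hs : effective m (fun v => \sum_(i < a v) (i.+1 * b v <= a v)).
  apply: (eff_sum (F := fun i v => (i.+1 * b v <= a v) : nat) _ ha).
  apply: eff_leq; last exact: eff_behead.
  by apply: eff_mul; [exact/eff_succ/eff_nth|exact: eff_behead].
apply: eff_ext (eff_if h0 (eff_const m 0) hs) _ => v _.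
rewrite leqn0; case: eqP => [->|/eqP]; first by rewrite divn0.
rewrite -lt0n => b0; rewrite -[RHS](@count_ltn (a v)) ?leq_div //.
by apply: eq_bigr => i _; rewrite leq_divRL.
Qed.

Lemma eff_odd m a : effective m a -> effective m (fun v => odd (a v) : nat).
Proof.
move=> ha.
apply: eff_ext (eff_sub ha (eff_mul (eff_div ha (eff_const m 2)) (eff_const m 2))) _.
by move=> v _; rewrite -modn2 {1}(divn_eq (a v) 2) addnC addnK.
Qed.

Lemma eff_logn2 m a : effective m a -> effective m (fun v => logn 2 (a v)).
Proof.
move=> ha.
apply: eff_ext (eff_sum (F := fun i v => (2 ^ i.+1 %| a v) : nat) _ (eff_pred ha)) _.
  have he : effective m.+1 (fun v => 2 ^ (nth 0 v 0).+1).
    by apply: eff_exp (eff_const _ 2) _; apply/eff_succ/eff_nth.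
  have hb := eff_behead ha.
  apply: eff_ext (eff_leq (eff_sub hb (eff_mul (eff_div hb he) he))
    (eff_const m.+1 0)) _ => v _.
  rewrite leqn0 /dvdn; congr (nat_of_bool (_ == _)).
  by rewrite {1}(divn_eq (a (behead v)) (2 ^ (nth 0 v 0).+1)) addnC addnK.
move=> v _; rewrite logn_count_dvd //.
case: (a v) => [|k]; first by rewrite big_geq ?big_ord0.
by rewrite big_add1 big_mkord.
Qed.

Definition code_tail n := n %/ 2 ^ logn 2 n %/ 2.

Lemma logn2_code x s : logn 2 (CodeSeq.code (x :: s)) = x.
Proof.
rewrite /= lognM ?expn_gt0 // pfactorK // logn_coprime ?addn0 //.
by rewrite coprime2n /= odd_double.
Qed.

Lemma code_tail_code s n :
  iter n code_tail (CodeSeq.code s) = CodeSeq.code (drop n s).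
Proof.
elim: n s => [|n IH] s; first by rewrite drop0.
case: s => [|x s] /=.
  by elim: n {IH} => // n IH; rewrite iterS IH /code_tail logn0.
rewrite -iterS iterSr -/(CodeSeq.code (x :: s)) -IH; congr (iter n code_tail _).
rewrite /code_tail logn2_code /= mulKn ?expn_gt0 //.
by rewrite divn2 /= uphalf_double.
Qed.

Lemma eff_iter_tail m a n : effective m a -> effective m n ->
  effective m (fun v => iter (n v) code_tail (a v)).
Proof.
move=> ha hn.
apply: eff_ext (eff_rec (g := fun _ z _ => code_tail z) ha _ hn) _.
  have hz := eff_nth m.+2 1.
  apply: eff_div (eff_const _ 2); apply: eff_div => //.
  by apply: eff_exp (eff_const _ 2) _; exact: eff_logn2.
by move=> v _; elim: (n v) => //= k ->.
Qed.

Lemma eff_nth_decode m a n : effective m a -> effective m n ->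
  effective m (fun v => nth 0 (CodeSeq.decode (a v)) (n v)).
Proof.
move=> ha hn; apply: eff_ext (eff_logn2 (eff_iter_tail ha hn)) _ => v _.
rewrite -{1}(CodeSeq.decodeK (a v)); move: (CodeSeq.decode (a v)) (n v) => s i.
rewrite code_tail_code -[in RHS](addn0 i) -nth_drop.
by case: (drop i s) => [|x t]; rewrite ?logn0 // logn2_code.
Qed.

Lemma eff_size_decode m a : effective m a ->
  effective m (fun v => size (CodeSeq.decode (a v))).
Proof.
move=> ha.
have h : effective m
    (fun v => \sum_(i < a v) (0 < iter i code_tail (a v))).
  apply: (eff_sum (F := fun i v => (0 < iter i code_tail (a v)) : nat) _ ha).
  apply: eff_leq (eff_const _ 1) _.
  by apply: eff_iter_tail; [exact: eff_behead|exact: eff_nth].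
apply: eff_ext h _ => v _; have := CodeSeq.decodeK (a v).
move: (CodeSeq.decode (a v)) => s <- {a ha v}.
have le_s : size s <= CodeSeq.code s.
  elim: s => //= x s IH; apply: leq_ltn_trans IH _.
  by rewrite -[ltnLHS]mul1n -muln2 (leq_trans _ (leq_pmull _ _)) ?expn_gt0 //; lia.
rewrite -[RHS](count_ltn le_s); apply: eq_bigr => i _.
rewrite code_tail_code -[i < size s]subn_gt0 -size_drop.
by case: (drop i s) => //= x t; rewrite muln_gt0 expn_gt0.
Qed.

Lemma eff_code_nil m : effective m (fun=> CodeSeq.code [::]).
Proof. exact: eff_const. Qed.

Lemma eff_code_cons m a s : effective m a ->
  effective m (fun v => CodeSeq.code (s v)) ->
  effective m (fun v => CodeSeq.code (a v :: s v)).
Proof.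
move=> ha hs; apply: eff_mul (eff_exp (eff_const _ 2) ha) _.
apply: eff_ext (eff_succ (eff_mul (eff_const _ 2) hs)) _ => v _.
by rewrite mul2n.
Qed.

Fixpoint forget_oracle (e : prog) : prog :=
  match e with
  | POracle => PZero
  | PComp f gs => PComp (forget_oracle f) (map forget_oracle gs)
  | PRec f g => PRec (forget_oracle f) (forget_oracle g)
  | PMu f => PMu (forget_oracle f)
  | e => e
  end.

Scheme runs_mut := Minimality for runs Sort Prop
  with runs_all_mut := Minimality for runs_all Sort Prop.

Lemma forget_oracleP O e v y :
  runs no_oracle e v y -> runs O (forget_oracle e) v y.
Proof.
pose Q (es : seq prog) v ws := runs_all O (map forget_oracle es) v ws.
move: e v y.
apply: (@runs_mut _ (fun e v y => runs O (forget_oracle e) v y) Q) => /=.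
- exact: runs_zero.
- exact: runs_succ.
- exact: runs_proj.
- by move=> v; exact: runs_zero.
- by move=> f gs v ws y _ hgs _ hf; exact: runs_comp hgs hf.
- by move=> f g v y _ hf; exact: runs_rec0.
- by move=> f g n v z y _ hz _ hg; exact: runs_recS hz hg.
- by move=> f v n w _ hw _ h0; exact: runs_mu hw h0.
- exact: runs_nil.
- by move=> g gs v w ws _ hg _ hgs; exact: runs_cons hg hgs.
Qed.

Lemma effective1 (f : nat -> nat) :
  computable_fun f -> effective 1 (fun v => f (nth 0%N v 0)).
Proof.
case=> e he; exists (forget_oracle e) => O [|n []] //= _.
exact: forget_oracleP.
Qed.

Lemma effective3 (f : nat -> nat -> nat -> nat) e :
  (forall i j k, runs no_oracle e [:: i; j; k] (f i j k)) ->
  effective 3 (fun v => f (nth 0%N v 0) (nth 0%N v 1) (nth 0%N v 2)).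
Proof.
move=> he; exists (forget_oracle e) => O [|i [|j [|k []]]] //= _.
exact: forget_oracleP.
Qed.

Local Open Scope classical_set_scope.
Local Open Scope ring_scope.

(** * Computable rationals *)

Definition eff_rat m (q : seq nat -> rat) :=
  exists2 F, effective m F & forall v, size v = m -> q v = rat_of_code (F v).

Lemma eff_ratP m q : eff_rat m q <-> exists a b c,
  [/\ effective m a, effective m b, effective m c &
   forall v, size v = m -> q v = ((a v)%:R - (b v)%:R) / (c v).+1%:R].
Proof.
split=> [[F hF qF]|[a] [b] [c] [ha hb hc qE]].
  exists (fun v => nth 0%N (CodeSeq.decode (F v)) 0).
  exists (fun v => nth 0%N (CodeSeq.decode (F v)) 1).
  exists (fun v => nth 0%N (CodeSeq.decode (F v)) 2).
  by split; do ?by apply: eff_nth_decode (eff_const _ _); exact: hF.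
exists (fun v => CodeSeq.code [:: a v; b v; c v]).
  by do !apply: eff_code_cons => //; exact: eff_code_nil.
by move=> v /qE ->; rewrite /rat_of_code CodeSeq.codeK.
Qed.

Lemma eff_rat_ext m q r : eff_rat m q -> (forall v, size v = m -> q v = r v) ->
  eff_rat m r.
Proof. by case=> F hF qF qr; exists F => // v vm; rewrite -qr ?qF. Qed.

Lemma eff_rat_frac m a b c : effective m a -> effective m b -> effective m c ->
  eff_rat m (fun v => ((a v)%:R - (b v)%:R) / (c v).+1%:R).
Proof. by move=> ha hb hc; apply/eff_ratP; exists a, b, c. Qed.

Lemma eff_rat_of_code m a :
  effective m a -> eff_rat m (fun v => rat_of_code (a v)).
Proof. by exists a. Qed.

Lemma eff_rat_nat m a : effective m a -> eff_rat m (fun v => (a v)%:R).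
Proof.
move=> ha; apply: eff_rat_ext (eff_rat_frac ha (eff_const m 0) (eff_const m 0)) _.
by move=> v _; rewrite subr0 divr1.
Qed.

Lemma eff_rat_add m q r : eff_rat m q -> eff_rat m r ->
  eff_rat m (fun v => q v + r v).
Proof.
move=> /eff_ratP[a] [b] [c] [ha hb hc qE] /eff_ratP[a'] [b'] [c'] [ha' hb' hc' rE].
apply: eff_rat_ext (eff_rat_frac
  (eff_add (eff_mul ha (eff_succ hc')) (eff_mul ha' (eff_succ hc)))
  (eff_add (eff_mul hb (eff_succ hc')) (eff_mul hb' (eff_succ hc)))
  (eff_pred (eff_mul (eff_succ hc) (eff_succ hc')))) _ => v vm.
rewrite qE // rE // prednK ?muln_gt0 // !natrD !natrM.
have c0 : (c v).+1%:R != 0 :> rat by rewrite pnatr_eq0.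
have c0' : (c' v).+1%:R != 0 :> rat by rewrite pnatr_eq0.
by field; rewrite ?nat1r c0 c0'.
Qed.

Lemma eff_rat_mul m q r : eff_rat m q -> eff_rat m r ->
  eff_rat m (fun v => q v * r v).
Proof.
move=> /eff_ratP[a] [b] [c] [ha hb hc qE] /eff_ratP[a'] [b'] [c'] [ha' hb' hc' rE].
apply: eff_rat_ext (eff_rat_frac
  (eff_add (eff_mul ha ha') (eff_mul hb hb'))
  (eff_add (eff_mul ha hb') (eff_mul hb ha'))
  (eff_pred (eff_mul (eff_succ hc) (eff_succ hc')))) _ => v vm.
rewrite qE // rE // prednK ?muln_gt0 // !natrD !natrM.
have c0 : (c v).+1%:R != 0 :> rat by rewrite pnatr_eq0.
have c0' : (c' v).+1%:R != 0 :> rat by rewrite pnatr_eq0.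
by field; rewrite ?nat1r c0 c0'.
Qed.

Lemma eff_rat_le m q r : eff_rat m q -> eff_rat m r ->
  effective m (fun v => (q v <= r v)%R : nat).
Proof.
move=> /eff_ratP[a] [b] [c] [ha hb hc qE] /eff_ratP[a'] [b'] [c'] [ha' hb' hc' rE].
apply: eff_ext (eff_leq
  (eff_add (eff_mul ha (eff_succ hc')) (eff_mul hb' (eff_succ hc)))
  (eff_add (eff_mul ha' (eff_succ hc)) (eff_mul hb (eff_succ hc')))) _ => v vm.
rewrite qE // rE // ler_pdivrMr ?ltr0Sn // mulrAC ler_pdivlMr ?ltr0Sn //.
by rewrite !mulrBl lerBlDr addrAC lerBrDr -(ler_nat rat) !natrD !natrM.
Qed.

Lemma eff_rat_if m (c : seq nat -> bool) q r :
  effective m (fun v => c v : nat) -> eff_rat m q -> eff_rat m r ->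
  eff_rat m (fun v => if c v then q v else r v).
Proof.
move=> hc [F hF qF] [G hG rG].
exists (fun v => if c v then F v else G v); first exact: eff_if.
by move=> v vm; case: (c v); [exact: qF|exact: rG].
Qed.

Lemma eff_rat_min m q r : eff_rat m q -> eff_rat m r ->
  eff_rat m (fun v => Num.min (q v) (r v)).
Proof.
move=> hq hr; apply: eff_rat_ext (eff_rat_if (eff_rat_le hq hr) hq hr) _ => v _.
by rewrite minEle.
Qed.

Lemma eff_rat_max m q r : eff_rat m q -> eff_rat m r ->
  eff_rat m (fun v => Num.max (q v) (r v)).
Proof.
move=> hq hr; apply: eff_rat_ext (eff_rat_if (eff_rat_le hq hr) hr hq) _ => v _.
by rewrite maxEle.
Qed.

Lemma eff_rat_rec (op : rat -> rat -> rat) m q0 r n :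
  (forall k q q', eff_rat k q -> eff_rat k q' ->
    eff_rat k (fun v => op (q v) (q' v))) ->
  eff_rat m q0 -> eff_rat m.+1 (fun w => r (nth 0%N w 0) (behead w)) ->
  effective m n ->
  eff_rat m (fun v =>
    nat_rect (fun=> rat) (q0 v) (fun i z => op z (r i v)) (n v)).
Proof.
move=> hop [F0 hF0 q0E] [F hF rE] hn.
have [G hG opE] := hop 2 _ _ (eff_rat_of_code (eff_nth 2 0))
  (eff_rat_of_code (eff_nth 2 1)).
exists (fun v => nat_rect (fun=> nat) (F0 v)
  (fun i z => G [:: z; F (i :: v)]) (n v)).
  apply: (eff_rec (g := fun i z v => G [:: z; F (i :: v)]) hF0 _ hn).
  have := eff_comp (gs := [:: nth 0%N ^~ 1;
    fun w => F (nth 0%N w 0 :: behead (behead w))]) hG erefl.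
  by apply; split; [exact: eff_nth|split=> //; exact: eff_skip].
move=> v vm; elim: (n v) => [|k /= ->]; first exact: q0E.
by have /= -> := rE (k :: v) (congr1 S vm); rewrite -opE.
Qed.

Lemma eff_rat_sum m r n :
  eff_rat m.+1 (fun w => r (nth 0%N w 0) (behead w)) -> effective m n ->
  eff_rat m (fun v => \sum_(i < n v) r i v).
Proof.
move=> hr hn; apply: eff_rat_ext (eff_rat_rec eff_rat_add
  (eff_rat_nat (eff_const m 0)) hr hn) _ => v _.
elim: (n v) => [|k /= ->]; first by rewrite big_ord0.
by rewrite big_ord_recr.
Qed.

Lemma eff_rat_prod m r n :
  eff_rat m.+1 (fun w => r (nth 0%N w 0) (behead w)) -> effective m n ->
  eff_rat m (fun v => \prod_(i < n v) r i v).
Proof.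
move=> hr hn; apply: eff_rat_ext (eff_rat_rec eff_rat_mul
  (eff_rat_nat (eff_const m 1)) hr hn) _ => v _.
elim: (n v) => [|k /= ->]; first by rewrite big_ord0.
by rewrite big_ord_recr.
Qed.

Lemma eff_rat_comp n m q gs : eff_rat n q -> size gs = n -> effectives m gs ->
  eff_rat m (fun v => q [seq g v | g <- gs]).
Proof.
case=> F hF qF gsn hgs; exists (fun v => F [seq g v | g <- gs]).
  exact: eff_comp hF gsn hgs.
by move=> v _; rewrite qF ?size_map.
Qed.

Definition isqrt n := (\sum_(i < n) (i.+1 ^ 2 <= n))%N.

Lemma isqrtP n : (isqrt n ^ 2 <= n < (isqrt n).+1 ^ 2)%N.
Proof.
have [q /andP[qn nq]] : exists q, (q ^ 2 <= n < q.+1 ^ 2)%N.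
  elim: n => [|n [q /andP[qn nq]]]; first by exists 0%N.
  have [le_nq|lt_nq] := ltnP n.+1 (q.+1 ^ 2)%N; first by exists q; rewrite (leqW qn).
  by exists q.+1; rewrite lt_nq (leq_ltn_trans nq) // ltn_exp2r.
suff -> : isqrt n = q by rewrite qn.
have le_qn : (q <= n)%N by apply: leq_trans qn; nia.
rewrite -[RHS](count_ltn le_qn); apply: eq_bigr => i _; congr nat_of_bool.
by apply/idP/idP => [iq|iq]; nia.
Qed.

Lemma eff_isqrt m a : effective m a -> effective m (fun v => isqrt (a v)).
Proof.
move=> ha; apply: (eff_sum (F := fun i v => (i.+1 ^ 2 <= a v)%N : nat) _ ha).
apply: eff_leq; last exact: eff_behead.
by apply: eff_exp (eff_const _ 2); apply/eff_succ/eff_nth.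
Qed.

Lemma eff_rat_sqrt m q j : eff_rat m q -> effective m j ->
  exists2 N, effective m N & forall v, size v = m -> 0 <= q v ->
    (N v)%:R ^+ 2 <= q v * (2 ^+ j v) ^+ 2 < (N v).+1%:R ^+ 2.
Proof.
move=> /eff_ratP[a] [b] [c] [ha hb hc qE] hj.
exists (fun v => isqrt ((a v - b v) * (2 ^ j v) ^ 2 %/ (c v).+1)).
  apply: eff_isqrt; apply: eff_div (eff_succ hc); apply: eff_mul (eff_sub ha hb) _.
  by apply: eff_exp (eff_const _ 2); apply: eff_exp (eff_const _ 2) hj.
move=> v vm; rewrite qE // pmulr_lge0 ?invr_gt0 ?ltr0Sn // subr_ge0 ler_nat => ba.
set M := (_ * _)%N; have /andP[h1 h2] := isqrtP (M %/ (c v).+1).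
set s := isqrt _ in h1 h2 *.
rewrite -natrB // -[2 ^+ j v]natrX -[_%:R ^+ 2]natrX -natrX mulrAC -natrM -/M.
rewrite ler_pdivlMr ?ltr0Sn // ltr_pdivrMr ?ltr0Sn // -natrX -!natrM ler_nat ltr_nat.
by rewrite -leq_divRL // h1 -ltn_divLR.
Qed.

(** * Values of *-polynomials at real assignments *)

Section complex_modulus.
Context {R : realType}.
Implicit Types z w : R[i].

Definition cmod z : R := complex.Re `|z|.

Lemma cmodE z : cmod z = Num.sqrt (complex.Re z ^+ 2 + complex.Im z ^+ 2).
Proof. by rewrite /cmod normc_def. Qed.

Lemma cmod_ge0 z : 0 <= cmod z.
Proof. by rewrite cmodE sqrtr_ge0. Qed.

Lemma cmodD z w : cmod (z + w) <= cmod z + cmod w.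
Proof. exact: le_normcD. Qed.

Lemma cmodN z : cmod (- z) = cmod z.
Proof. exact: normcN. Qed.

Lemma cmodM z w : cmod (z * w) = cmod z * cmod w.
Proof. exact: Normc.normcM. Qed.

Lemma cmod0 : cmod 0 = 0.
Proof. exact: Normc.normc0. Qed.

Lemma cmod_real (x : R) : cmod x%:C%C = `|x|.
Proof. by rewrite cmodE /= expr0n addr0 sqrtr_sqr. Qed.

Lemma cmod_ReIm z : cmod z <= `|complex.Re z| + `|complex.Im z|.
Proof.
rewrite cmodE -[leRHS]ger0_norm ?addr_ge0// -sqrtr_sqr ler_sqrt ?sqr_ge0//.
rewrite [leRHS]sqrrD !real_normK ?num_real// addrAC lerDl.
by rewrite mulrn_wge0 // mulr_ge0.
Qed.

Lemma complexMr (x y r : R) : Complex x y * r%:C%C = Complex (x * r) (y * r).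
Proof. by rewrite /GRing.mul /= !mulr0 subr0 add0r. Qed.

Lemma Re_le_cmod z : `|complex.Re z| <= cmod z.
Proof. by rewrite cmodE -sqrtr_sqr ler_sqrt ?addr_ge0 ?sqr_ge0 // lerDl sqr_ge0. Qed.

Lemma Im_le_cmod z : `|complex.Im z| <= cmod z.
Proof. by rewrite cmodE -sqrtr_sqr ler_sqrt ?addr_ge0 ?sqr_ge0 // lerDr sqr_ge0. Qed.

Lemma cmod_sub_le z w : `|cmod z - cmod w| <= cmod (z - w).
Proof.
rewrite ler_norml lerNl opprB !lerBlDr; apply/andP; split.
  by rewrite -(cmodN (z - w)) opprB; apply: le_trans (cmodD _ _); rewrite subrK.
by apply: le_trans (cmodD _ _); rewrite subrK.
Qed.

Lemma cmod_sum I (s : seq I) (F : I -> R[i]) :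
  cmod (\sum_(i <- s) F i) <= \sum_(i <- s) cmod (F i).
Proof.
elim: s => [|i s IH]; first by rewrite !big_nil cmod0.
by rewrite !big_cons (le_trans (cmodD _ _)) // lerD2l.
Qed.

End complex_modulus.

Section real_polynomials.
Context {R : realType}.
Implicit Types a b : nat -> R.

Definition peval (P : starpoly) a : R[i] :=
  \sum_(t <- P) gaussr t.1 * (\prod_(l <- t.2) a l.1)%:C%C.

Lemma prod_01 I (s : seq I) (f : I -> R) : (forall i, 0 <= f i <= 1) ->
  0 <= \prod_(i <- s) f i <= 1.
Proof.
move=> f01; elim: s => [|i s /andP[IH0 IH1]]; first by rewrite big_nil ler01 lexx.
have /andP[f0 f1] := f01 i.
by rewrite big_cons mulr_ge0 //= mulr_ile1.
Qed.

Lemma prod_perturb I (s : seq I) (f g : I -> R) e :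
  (forall i, 0 <= f i <= 1) -> (forall i, 0 <= g i <= 1) ->
  (forall i, `|f i - g i| <= e) ->
  `|\prod_(i <- s) f i - \prod_(i <- s) g i| <= (size s)%:R * e.
Proof.
move=> f01 g01 fg; elim: s => [|i s IH]; first by rewrite !big_nil subrr normr0 mul0r.
rewrite !big_cons; set p := \prod_(j <- s) f j in IH *.
set q := \prod_(j <- s) g j in IH *.
have /andP[q0 q1] : 0 <= q <= 1 := prod_01 s g01.
have /andP[f0 f1] := f01 i.
rewrite (_ : _ - _ = f i * (p - q) + (f i - g i) * q); last by ring.
rewrite (le_trans (ler_normD _ _)) // !normrM (ger0_norm f0) (ger0_norm q0).
rewrite -nat1r mulrDl mul1r [leRHS]addrC lerD //.
  by rewrite -[leRHS]mul1r ler_pM.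
by rewrite -[leRHS]mulr1 ler_pM.
Qed.

Lemma peval_perturb (P : starpoly) a b e :
  (forall i, 0 <= a i <= 1) -> (forall i, 0 <= b i <= 1) ->
  (forall i, `|a i - b i| <= e) ->
  cmod (peval P a - peval P b) <=
    (\sum_(t <- P) cmod (gaussr t.1) * (size t.2)%:R) * e.
Proof.
move=> a01 b01 ab; rewrite /peval -sumrB (le_trans (cmod_sum _ _)) // mulr_suml.
apply: ler_sum => t _; rewrite -mulrBr cmodM -rmorphB cmod_real -mulrA.
by rewrite ler_wpM2l ?cmod_ge0 // prod_perturb.
Qed.

End real_polynomials.

Notation digit n i := (nth 0%N (CodeSeq.decode n) i).
Notation digits n := (size (CodeSeq.decode n)).

Definition rat_weight c := (digit c 0 + digit c 1)%N.

Definition poly_weight n := (\sum_(i < digits n)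
  (rat_weight (digit (digit (digit n i) 0) 0) +
   rat_weight (digit (digit (digit n i) 0) 1)) * (digits (digit n i)).-1)%N.

(* The real (k = 0) or imaginary (k = 1) part of the value at x_s = al s. *)
Definition poly_part (k : nat) (al : nat -> rat) n : rat :=
  \sum_(i < digits n) rat_of_code (digit (digit (digit n i) 0) k) *
    \prod_(j < (digits (digit n i)).-1) al (digit (digit n i) j.+1)./2.

Lemma sum_code (V : nmodType) (F : rat[i] * seq (nat * bool) -> V) n :
  \sum_(t <- starpoly_of_code n) F t =
  \sum_(i < digits n) F (term_of_code (digit n i)).
Proof. by rewrite big_map (big_nth 0%N) big_mkord. Qed.

Lemma term_of_codeE (t : nat) :
  term_of_code t = (gauss_of_code (digit t 0),
    map letter_of_code (behead (CodeSeq.decode t))).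
Proof. by rewrite /term_of_code nth0. Qed.

Section weights.
Context {R : realType}.

Lemma rat_weightP c : `|ratr (rat_of_code c) : R| <= (rat_weight c)%:R.
Proof.
rewrite /rat_of_code /rat_weight.
move: (digit c 0) (digit c 1) (digit c 2) => x y z.
rewrite fmorph_div rmorphB /= !ratr_nat normrM normfV (ger0_norm (ler0n _ z.+1)).
rewrite ler_pdivrMr ?ltr0Sn // (le_trans (ler_normB _ _)) // !normr_nat -natrD.
by rewrite ler_peMr // ler1n.
Qed.

Lemma poly_weightP n :
  \sum_(t <- starpoly_of_code n) cmod (gaussr t.1 : R[i]) * (size t.2)%:R <=
    (poly_weight n)%:R.
Proof.
rewrite sum_code /poly_weight natr_sum; apply: ler_sum => i _.
rewrite term_of_codeE /= size_map size_behead natrM ler_wpM2r //.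
rewrite (le_trans (cmod_ReIm _)) // natrD.
by rewrite lerD // rat_weightP.
Qed.

Lemma peval_code_perturb n (a b : nat -> R) e : 0 <= e ->
  (forall i, 0 <= a i <= 1) -> (forall i, 0 <= b i <= 1) ->
  (forall i, `|a i - b i| <= e) ->
  cmod (peval (starpoly_of_code n) a - peval (starpoly_of_code n) b) <=
    (poly_weight n)%:R * e.
Proof.
move=> e0 a01 b01 ab; apply: le_trans (peval_perturb _ a01 b01 ab) _.
by rewrite ler_wpM2r // poly_weightP.
Qed.

Lemma peval_ratr n (al : nat -> rat) :
  peval (starpoly_of_code n) (fun s => ratr (al s)) =
  Complex (ratr (poly_part 0 al n)) (ratr (poly_part 1 al n)) :> R[i].
Proof.
have ReS (I : Type) (s : seq I) (F : I -> R[i]) : \sum_(i <- s) F i =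
    Complex (\sum_(i <- s) complex.Re (F i)) (\sum_(i <- s) complex.Im (F i)).
  elim: s => [|i s IH]; first by rewrite !big_nil.
  by rewrite !big_cons IH; case: (F i).
have termE t : gaussr (term_of_code t).1 *
      (\prod_(l <- (term_of_code t).2) ratr (al l.1))%:C%C = Complex
    (ratr (rat_of_code (digit (digit t 0) 0) *
      \prod_(j < (digits t).-1) al (digit t j.+1)./2))
    (ratr (rat_of_code (digit (digit t 0) 1) *
      \prod_(j < (digits t).-1) al (digit t j.+1)./2)) :> R[i].
  have -> : \prod_(l <- (term_of_code t).2) ratr (al l.1) =
      ratr (\prod_(j < (digits t).-1) al (digit t j.+1)./2) :> R.
    rewrite term_of_codeE big_map (big_nth 0%N) big_mkord size_behead rmorph_prod.
    by apply: eq_bigr => j _; rewrite nth_behead.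
  by rewrite term_of_codeE [LHS]complexMr !rmorphM.
rewrite /peval sum_code ReS /poly_part !rmorph_sum.
by congr Complex; apply: eq_bigr => i _; rewrite termE.
Qed.

End weights.

Definition minupto (K : realFieldType) (f : nat -> K) n : K :=
  nat_rect (fun=> K) 1 (fun i z => Num.min z (f i)) n.

Section minupto.
Context {K : realFieldType}.
Implicit Types (f g : nat -> K).

Lemma minupto_01 f n : (forall i, 0 <= f i) -> 0 <= minupto f n <= 1.
Proof.
move=> f0; elim: n => [|n /andP[IH0 IH1]] /=; first by rewrite ler01 lexx.
by rewrite le_min IH0 f0 ge_min IH1.
Qed.

Lemma minupto_perturb f g e n : 0 <= e -> (forall i, `|f i - g i| <= e) ->
  `|minupto f n - minupto g n| <= e.
Proof.
move=> e0 fg; elim: n => [|n IH] /=; first by rewrite subrr normr0.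
move: IH (fg n); rewrite !ler_norml; rewrite /Num.min.
by case: ifP => ?; case: ifP => ?; lra.
Qed.

Lemma minupto_le f n i : (i < n)%N -> minupto f n <= f i.
Proof.
elim: n => // n IH; rewrite ltnS leq_eqVlt => /orP[/eqP ->|/IH h] /=.
  by rewrite ge_min lexx orbT.
by rewrite ge_min h.
Qed.

Lemma minupto_ge f n c : c <= 1 -> (forall i, (i < n)%N -> c <= f i) ->
  c <= minupto f n.
Proof.
move=> c1; elim: n => //= n IH h; rewrite le_min h // andbT.
by apply: IH => i /leqW; exact: h.
Qed.

End minupto.

Lemma ratr_minupto (K : realFieldType) (f : nat -> rat) n :
  ratr (minupto f n) = minupto (fun i => ratr (f i)) n :> K.
Proof.
elim: n => [|n /= <-] /=; first by rewrite rmorph1.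
by rewrite !minEle ler_rat; case: ifP.
Qed.

Lemma eff_digit m a n : effective m a -> effective m n ->
  effective m (fun v => digit (a v) (n v)).
Proof. exact: eff_nth_decode. Qed.

Lemma eff_poly_weight m a : effective m a ->
  effective m (fun v => poly_weight (a v)).
Proof.
move=> ha; apply: (eff_sum (F := fun i v =>
  ((rat_weight (digit (digit (digit (a v) i) 0) 0) +
   rat_weight (digit (digit (digit (a v) i) 0) 1)) *
   (digits (digit (a v) i)).-1)%N) _ (eff_size_decode ha)).
have ht := eff_digit (eff_behead ha) (eff_nth m.+1 0).
have hc := eff_digit ht (eff_const _ 0).
have hw k : effective m.+1
    (fun w => rat_weight (digit (digit (digit (a (behead w)) (nth 0%N w 0)) 0) k)).
  have hk := eff_digit hc (eff_const _ k).
  by apply: eff_add; apply: eff_digit hk (eff_const _ _).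
exact: eff_mul (eff_add (hw _) (hw _)) (eff_pred (eff_size_decode ht)).
Qed.

Lemma eff_poly_part k (al : nat -> nat -> nat -> rat) :
  eff_rat 3 (fun v => al (nth 0%N v 0) (nth 0%N v 1) (nth 0%N v 2)) ->
  eff_rat 3 (fun v =>
    poly_part k (fun s => al s (nth 0%N v 1) (nth 0%N v 2)) (nth 0%N v 0)).
Proof.
move=> hal; apply: (eff_rat_sum (r := fun i v =>
  rat_of_code (digit (digit (digit (nth 0%N v 0) i) 0) k) *
  \prod_(j < (digits (digit (nth 0%N v 0) i)).-1)
    al (digit (digit (nth 0%N v 0) i) j.+1)./2 (nth 0%N v 1) (nth 0%N v 2)));
  last exact/eff_size_decode/eff_nth.
have ht := eff_digit (eff_behead (eff_nth 3 0)) (eff_nth 4 0).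
apply: eff_rat_mul.
  apply: eff_rat_of_code; apply: eff_digit (eff_const _ _).
  exact: eff_digit ht (eff_const _ 0).
apply: (eff_rat_prod (r := fun j w =>
  al (digit (digit (nth 0%N (behead w) 0) (nth 0%N w 0)) j.+1)./2
    (nth 0%N (behead w) 1) (nth 0%N (behead w) 2)));
  last exact: eff_pred (eff_size_decode ht).
have hn i : effective 5 (fun u => nth 0%N (behead (behead u)) i).
  exact: eff_behead2 (eff_nth 3 i).
have hs : effective 5 (fun u => (digit (digit (nth 0%N (behead (behead u)) 0)
    (nth 0%N (behead u) 0)) (nth 0%N u 0).+1)./2).
  have hd : effective 5 (fun u => digit (digit (nth 0%N (behead (behead u)) 0)
      (nth 0%N (behead u) 0)) (nth 0%N u 0).+1).
    apply: eff_digit; last exact/eff_succ/eff_nth.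
    by apply: eff_digit (hn 0%N) _; exact: (eff_behead (eff_nth 4 0)).
  by apply: eff_ext (eff_div hd (eff_const _ 2)) _ => v _; rewrite divn2.
exact: (eff_rat_comp (gs := [:: _; _; _]) hal erefl
  (conj hs (conj (hn 1%N) (conj (hn 2%N) I)))).
Qed.

(** * Functions on a compact metric space *)

Section small_powers.
Context {R : realType}.

Lemma half_pow_gt0 k : 0 < 2 ^- k :> R.
Proof. by rewrite invr_gt0 exprn_gt0. Qed.

Lemma exists_nat_gt (x : R) : exists n, x < n%:R.
Proof.
exists (Num.bound `|x|); apply: le_lt_trans (ler_norm _) _.
exact: archi_boundP.
Qed.

Lemma half_pow_anti m n : (m <= n)%N -> 2 ^- n <= 2 ^- m :> R.
Proof. by move=> mn; rewrite lef_pV2 ?posrE ?exprn_gt0 // ler_weXn2l // ler1n. Qed.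

Lemma nat_half_pow n k : n%:R * 2 ^- (k + n) <= 2 ^- k :> R.
Proof.
rewrite ler_pdivrMr ?exprn_gt0 // exprD mulKf ?expf_neq0 //.
by rewrite -natrX ler_nat ltnW // ltn_expl.
Qed.

Lemma exists_half_pow (e : R) : 0 < e -> exists k, 2 ^- k < e.
Proof.
move=> e0; have [n hn] := exists_nat_gt e^-1; exists n.
rewrite -[ltRHS]invrK ltf_pV2 ?posrE ?exprn_gt0 ?invr_gt0 //.
by rewrite (lt_trans hn) // -natrX ltr_nat ltn_expl.
Qed.

End small_powers.

Section functions_on_compact.
Context {R : realType} {X : topologicalType} (P : polish_presentation R X).
Hypothesis X_compact : compact [set: X]%classic.
Notation d := (pp_dist P).
Notation p := (pp_pt P).
Implicit Types f : CX R X.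

Lemma pp_dist_ge0 x y : 0 <= d x y.
Proof. by case: (pp_compatible P) => -[]. Qed.

Lemma pp_distC x y : d x y = d y x.
Proof. by case: (pp_compatible P) => -[]. Qed.

Lemma pp_dist_triangle y x z : d x z <= d x y + d y z.
Proof. by case: (pp_compatible P) => -[]. Qed.

Lemma pp_dist_perturb x y z : `|d x y - d x z| <= d y z.
Proof.
have := pp_dist_triangle z x y; rewrite (pp_distC z y).
by have := pp_dist_triangle y x z; rewrite ler_norml; lra.
Qed.

Lemma nbhs_ball x e : 0 < e -> nbhs x [set y | d x y < e]%classic.
Proof. by case: (pp_compatible P) => _ nb e0; apply/nb; exists e. Qed.

Lemma lipschitz_cts (g : X -> R) : (forall x y, `|g x - g y| <= d x y) ->
  continuous (fun x => ((g x)%:C%C : (R[i])^o)).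
Proof.
move=> g_lip x; apply/cvgrPdist_lt => e e0.
have [e1 e2] : 0 < complex.Re e /\ complex.Im e = 0.
  by move: e0; case: e => a b; rewrite ltcE /= => /andP[/eqP ->].
apply: filterS (nbhs_ball x e1) => y /= xy.
have lt_e : cmod (g x - g y)%:C%C < complex.Re e.
  by rewrite cmod_real (le_lt_trans (g_lip x y)).
by rewrite -rmorphB ltcE; apply/andP; split; [rewrite e2|exact: lt_e].
Qed.

Lemma CX_cts f x e : 0 < e ->
  exists2 del, 0 < del & forall y, d x y < del -> cmod (f x - f y) < e.
Proof.
move=> e0; have /cvgrPdist_lt/(_ e%:C%C) := @cts_fun _ _ f x.
rewrite ltcR => /(_ e0); case: (pp_compatible P) => _ nb.
by move=> /nb[del del0 h]; exists del => // y /h /=; rewrite ltcE => /andP[_].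
Qed.

Lemma CX_bounded f : exists M : nat, forall x, cmod (f x) <= M%:R.
Proof.
have /compact_near_coveringP/(_ nat \oo
  (fun n x => cmod (f x) <= n%:R) _) := X_compact.
case=> [x _|N _ /(_ N (leqnn N)) h]; last by exists N => x; exact: h.
have [del del0 hd] := CX_cts f x ltr01.
have [n hn] := exists_nat_gt (cmod (f x) + 1).
exists ([set y | d x y < del], [set i | (n <= i)%N])%classic => /=.
  by split; [exact: nbhs_ball|exact: nbhs_infty_ge].
move=> [y i] /= [/hd xy ni]; apply: le_trans (_ : n%:R <= _); last by rewrite ler_nat.
have := cmod_sub_le (f x) (f y); rewrite ler_norml => /andP[h _].
by move: h xy hn; lra.
Qed.

Lemma CX_uniform f e : 0 < e ->
  exists2 del, 0 < del & forall x y, d x y < del -> cmod (f x - f y) < e.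
Proof.
move=> e0; have /compact_near_coveringP/(_ nat \oo
  (fun n x => forall y, d x y < 2 ^- n -> cmod (f x - f y) < e) _) := X_compact.
case=> [x _|N _ /(_ N (leqnn N)) h]; last first.
  by exists (2 ^- N) => [|x]; [exact: half_pow_gt0|exact: h].
have e20 : 0 < e / 2 by rewrite divr_gt0.
have [del del0 hd] := CX_cts f x e20.
have del20 : 0 < del / 2 by rewrite divr_gt0.
have [n hn] := exists_half_pow del20.
exists ([set y | d x y < del / 2], [set i | (n <= i)%N])%classic => /=.
  by split; [exact: nbhs_ball|exact: nbhs_infty_ge].
move=> [y i] /= [xy /(@half_pow_anti R) ni] z yz.
have xz := hd z; have {}hd := hd y.
have hy : cmod (f x - f y) < e / 2 by apply: hd; move: xy pp_dist_ge0; lra.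
have hz : cmod (f x - f z) < e / 2.
  by apply: xz; have := pp_dist_triangle y x z; move: ni hn xy yz; lra.
rewrite (_ : f y - f z = (f x - f z) - (f x - f y)); last by ring.
by rewrite (le_lt_trans (cmodD _ _)) // cmodN (splitr e) addrC ltrD.
Qed.

Lemma supnorm_ub f x : cmod (f x) <= supnorm f.
Proof.
have [M hM] := CX_bounded f.
apply: ub_le_sup; last by exists x.
by exists M%:R => _ [y _ <-]; exact: hM.
Qed.

Lemma supnorm_le f M : (forall x, cmod (f x) <= M) -> supnorm f <= M.
Proof.
move=> hM; apply: ge_sup; first by exists (cmod (f (p 0%N))); exists (p 0%N).
by move=> _ [y _ <-]; exact: hM.
Qed.

Lemma pp_dist_bounded : exists B : nat, forall x y, d x y <= B.+1%:R.
Proof.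
have [M hM] := CX_bounded (dist_fun P (p 0%N)); exists M.*2 => x y.
have hd z : d (p 0%N) z <= M%:R.
  by have := hM z; rewrite [cmod _]cmod_real ger0_norm ?pp_dist_ge0.
rewrite (le_trans (pp_dist_triangle (p 0%N) x y)) // pp_distC.
by rewrite (le_trans (lerD (hd x) (hd y))) // -natrD ler_nat addnn.
Qed.

End functions_on_compact.

(** * The generators *)

Section generators.
Context {R : realType} {X : topologicalType} (P : polish_presentation R X).
Hypothesis X_compact : compact [set: X].
Variable B : nat.
Notation d := (pp_dist P).
Notation p := (pp_pt P).
Implicit Types f : CX R X.

(* The entry e = code [:: k; a; b] stands for the point p_k and the offset
   a / (b + 1). *)
Definition offset e : rat := (digit e 1)%:R / (digit e 2).+1%:R.

Definition gen_val s x : R :=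
  minupto (fun i => ratr (offset (digit s i)) +
    d (p (digit (digit s i) 0)) x / B.+1%:R) (digits s).

Lemma offset_ge0 e : 0 <= offset e.
Proof. by rewrite divr_ge0. Qed.

Lemma gen_val_01 s x : 0 <= gen_val s x <= 1.
Proof.
apply: minupto_01 => i; rewrite addr_ge0 ?ler0q ?offset_ge0 //.
by rewrite divr_ge0 ?pp_dist_ge0.
Qed.

Lemma scaled_perturb (a b c e : R) : 0 <= e -> `|b - c| <= e ->
  `|(a + b / B.+1%:R) - (a + c / B.+1%:R)| <= e.
Proof.
move=> e0 bc; rewrite opprD addrACA subrr add0r -mulrBl normrM.
rewrite (le_trans _ bc) // ler_piMr // normfV normr_nat invf_le1 ?ltr0Sn //.
by rewrite ler1n.
Qed.

Lemma gen_val_lip s x y : `|gen_val s x - gen_val s y| <= d x y.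
Proof.
apply: minupto_perturb => [|i]; first exact: pp_dist_ge0.
by apply: scaled_perturb; [exact: pp_dist_ge0|exact: pp_dist_perturb].
Qed.

Definition gen s : CX R X := mkcts (lipschitz_cts (gen_val_lip s)).

Lemma starpoly_eval_gen Q x :
  starpoly_eval gen Q x = peval Q (fun s => gen_val s x).
Proof.
rewrite starpoly_evalE; apply: eq_bigr => t _; congr (_ * _).
rewrite rmorph_prod; apply: eq_bigr => l _.
by case: l.2; rewrite // [LHS]conjc_real.
Qed.

Lemma poly_lip n x y e : d x y <= e ->
  cmod (rational_vector gen n x - rational_vector gen n y) <=
    (poly_weight n)%:R * e.
Proof.
move=> xy; rewrite /rational_vector !starpoly_eval_gen.
have e0 : 0 <= e := le_trans (pp_dist_ge0 P x y) xy.
apply: peval_code_perturb => // s; do ?exact: gen_val_01.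
exact: le_trans (gen_val_lip s x y) xy.
Qed.

Lemma digits_code s : digits (CodeSeq.code s) = size s.
Proof. by rewrite CodeSeq.codeK. Qed.

Lemma approx_real (g : X -> R) (M : nat) (e : R) :
  (exists t, total_boundedness_function P t) ->
  (forall e : R, 0 < e -> exists2 del : R, 0 < del &
    forall x y, d x y < del -> `|g x - g y| < e) ->
  (forall x, `|g x| <= M%:R) -> 0 < e ->
  exists K s : nat, forall x, `|K%:R * gen_val s x - M%:R - g x| <= e.
Proof.
move=> [tb tbP] g_cts gM e0; set ep := e / 3.
have ep0 : 0 < ep by rewrite divr_gt0.
have [del del0 g_del] := g_cts _ ep0.
pose h x := g x + M%:R.
have h0 x : 0 <= h x by have := gM x; rewrite ler_norml /h; lra.
have hM x : h x <= (M + M)%:R by have := gM x; rewrite ler_norml natrD /h; lra.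
have [N hN] := exists_nat_gt ((M + M)%:R / del + (M + M)%:R + 1).
have M0 : 0 <= (M + M)%:R :> R by [].
have Mdel0 : 0 <= (M + M)%:R / del by rewrite divr_ge0 // ltW.
have N1 : 1 <= N%:R :> R by move: hN Mdel0 M0; lra.
have Ndel : (M + M)%:R <= N%:R * del.
  by rewrite -ler_pdivrMr //; move: hN M0; lra.
have [j /ltW hj] : exists j, 2 ^- j < Num.min del (ep / N%:R).
  by apply: exists_half_pow; rewrite lt_min del0 divr_gt0 //; lra.
have {hj} [hj Nj] : 2 ^- j <= del /\ N%:R * 2 ^- j <= ep.
  move: hj; rewrite le_min => /andP[-> le_ep]; split=> //.
  by rewrite mulrC -ler_pdivlMr //; lra.
pose K := (N * B.+1)%N.
have NK : N%:R <= K%:R :> R by rewrite ler_nat leq_pmulr.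
have K0 : 0 < K%:R :> R by lra.
have KB : K%:R / B.+1%:R = N%:R :> R by rewrite /K natrM mulfK // pnatr_eq0.
have [Q hQ] := exists_nat_gt (K%:R / ep).
have Q0 : 0 < Q%:R :> R by apply: lt_trans hQ; rewrite divr_gt0.
pose a i := (Num.trunc (h (p i) * Q.+1%:R / K%:R)).+1.
have aP i : h (p i) <= K%:R * ((a i)%:R / Q.+1%:R) <= h (p i) + ep.
  have Q10 : 0 < Q.+1%:R :> R by [].
  have /truncn_itv/andP[] : 0 <= h (p i) * Q.+1%:R / K%:R.
    by rewrite divr_ge0 ?mulr_ge0 // ltW.
  rewrite -/(a i) ler_pdivlMr // ltr_pdivrMr // => h1 h2.
  have KQ : K%:R <= ep * Q.+1%:R.
    rewrite mulrC -ler_pdivrMr //; apply: ltW; apply: lt_le_trans hQ _.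
    by rewrite ler_nat.
  rewrite mulrA ler_pdivlMr // ler_pdivrMr //; apply/andP; split.
    by rewrite [leRHS]mulrC ltW.
  by move: h1 KQ; rewrite /a -[(Num.trunc _).+1%:R]natr1; lra.
pose s := CodeSeq.code (mkseq (fun i => CodeSeq.code [:: i; a i; Q]) (tb j)).
have genE x : gen_val s x = minupto (fun i => ratr (offset (digit s i)) +
    d (p (digit (digit s i) 0)) x / B.+1%:R) (tb j).
  by rewrite /gen_val digits_code size_mkseq.
have entry i x : (i < tb j)%N ->
    ratr (offset (digit s i)) + d (p (digit (digit s i) 0)) x / B.+1%:R =
    (a i)%:R / Q.+1%:R + d (p i) x / B.+1%:R.
  move=> ij; rewrite /s CodeSeq.codeK nth_mkseq // /offset !CodeSeq.codeK.
  by rewrite fmorph_div /= !ratr_nat.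
exists K, s => x; rewrite genE ler_norml; apply/andP; split; last first.
  have : (\bigcup_(k in coded_set (tb j)) [set x | pm_dist (pm_pt P k) x < 2 ^- j]) x.
    by rewrite -tbP.
  case=> k k_tb /= kx.
  have ktb : (k < tb j)%N.
    rewrite ltnNge; apply: contraPN k_tb => tbk; rewrite /coded_set /=.
    by rewrite divn_small // (leq_ltn_trans tbk) // ltn_expl.
  have := minupto_le (fun i => ratr (offset (digit s i)) +
    d (p (digit (digit s i) 0)) x / B.+1%:R) ktb.
  rewrite entry // -(ler_pM2l K0) mulrDr [_ * (d _ _ / _)]mulrCA KB => le_u.
  have /andP[_ ha] := aP k.
  have hd : d (p k) x * N%:R <= ep.
    by rewrite mulrC (le_trans _ Nj) // ler_pM2l ?ltW //; lra.
  have := g_del (p k) x (lt_le_trans kx hj).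
  rewrite ltr_norml => /andP[_ hg].
  move: le_u ha hd hg; rewrite /h /ep.
  by move: (_ * minupto _ _) (_ * (_ / Q.+1%:R)) (_ * N%:R) => u v w; lra.
suff : (h x - ep) / K%:R <= minupto (fun i => ratr (offset (digit s i)) +
    d (p (digit (digit s i) 0)) x / B.+1%:R) (tb j).
  rewrite ler_pdivrMr // mulrC /h /ep.
  by move: (_ * minupto _ _) => u; lra.
apply: minupto_ge => [|i ij].
  by rewrite ler_pdivrMr // mul1r; have := hM x; move: hN Mdel0; lra.
rewrite entry // ler_pdivrMr // mulrC mulrDr [_ * (d _ _ / _)]mulrCA KB.
have /andP[ha _] := aP i.
have [/g_del|del_le] := ltP (d (p i) x) del.
  rewrite ltr_norml => /andP[hg _].
  have : 0 <= d (p i) x * N%:R by rewrite mulr_ge0 // pp_dist_ge0.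
  move: ha hg; rewrite /h.
  by move: (_ * (_ / Q.+1%:R)) (_ * N%:R) => v w; lra.
have : N%:R * del <= d (p i) x * N%:R by rewrite mulrC ler_pM2r //; lra.
move: ha Ndel (hM x) (h0 (p i)).
by move: (_ * (_ / Q.+1%:R)) (N%:R * del) (_ * N%:R) => u v w; lra.
Qed.

Lemma gen_dense (f : CX R X) (e : R) :
  (exists t, total_boundedness_function P t) -> 0 < e ->
  exists n, supnorm (rational_vector gen n - f) < e.
Proof.
move=> tb e0; have [M hM] := CX_bounded P X_compact f.
have e30 : 0 < e / 3 by rewrite divr_gt0.
have [K1 [s1 h1]] : exists K s : nat, forall x,
    `|K%:R * gen_val s x - M%:R - complex.Re (f x)| <= e / 3.
  apply: (approx_real tb) => // [e' e'0|x]; last exact: le_trans (Re_le_cmod _) (hM x).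
  have [del del0 hdel] := CX_uniform P X_compact f e'0; exists del => // x y /hdel.
  by apply: le_lt_trans; rewrite -raddfB; exact: Re_le_cmod.
have [K2 [s2 h2]] : exists K s : nat, forall x,
    `|K%:R * gen_val s x - M%:R - complex.Im (f x)| <= e / 3.
  apply: (approx_real tb) => // [e' e'0|x]; last exact: le_trans (Im_le_cmod _) (hM x).
  have [del del0 hdel] := CX_uniform P X_compact f e'0; exists del => // x y /hdel.
  by apply: le_lt_trans; rewrite -raddfB; exact: Im_le_cmod.
have [n hn] := starpoly_of_code_surj [:: (Complex K1%:R 0, [:: (s1, false)]);
  (Complex 0 K2%:R, [:: (s2, false)]); (Complex (- M%:R) (- M%:R), [::])].
exists n; apply: le_lt_trans (_ : e / 3 + e / 3 < e); last by lra.
apply: (supnorm_le P) => x; apply: le_trans (cmod_ReIm _) _.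
have -> : (rational_vector gen n - f) x = Complex
    (K1%:R * gen_val s1 x - M%:R - complex.Re (f x))
    (K2%:R * gen_val s2 x - M%:R - complex.Im (f x)).
  rewrite -[LHS]/(rational_vector gen n x - f x) /rational_vector hn.
  rewrite starpoly_eval_gen /peval !big_cons !big_nil /gaussr [LHS]/=.
  have ratrN : ratr (- M%:R) = - M%:R :> R by rewrite rmorphN /= ratr_nat.
  rewrite !complexMr !mulr1 addr0 !ratrN !ratr_nat !rmorph0 !mul0r.
  case: (f x) => u v.
  rewrite -[LHS]/(Complex (K1%:R * gen_val s1 x + (0 - M%:R) - u)
    (0 + (K2%:R * gen_val s2 x - M%:R) - v)).
  by rewrite !add0r.
exact: lerD (h1 x) (h2 x).
Qed.

End generators.

(** * Approximate evaluation *)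

Definition gen_approx (B : nat) (D : nat -> nat -> nat -> nat) s m k : rat :=
  minupto (fun i => offset (digit s i) +
    Num.max 0 (rat_of_code (D (digit (digit s i) 0) m k)) / B.+1%:R) (digits s).

Lemma gen_approx_01 B D s m k : 0 <= gen_approx B D s m k <= 1.
Proof.
apply: minupto_01 => i; rewrite addr_ge0 ?offset_ge0 //.
by rewrite divr_ge0 // le_max lexx.
Qed.

Lemma eff_gen_approx B D :
  effective 3 (fun v => D (nth 0%N v 0) (nth 0%N v 1) (nth 0%N v 2)) ->
  eff_rat 3 (fun v => gen_approx B D (nth 0%N v 0) (nth 0%N v 1) (nth 0%N v 2)).
Proof.
move=> hD; pose r i v : rat := offset (digit (nth 0%N v 0) i) +
  Num.max 0 (rat_of_code
    (D (digit (digit (nth 0%N v 0) i) 0) (nth 0%N v 1) (nth 0%N v 2))) / B.+1%:R.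
apply: (@eff_rat_rec Num.min 3 (fun=> 1) r _ eff_rat_min
  (eff_rat_nat (eff_const 3 1)) _ (eff_size_decode (eff_nth 3 0))).
have he := eff_digit (eff_behead (eff_nth 3 0)) (eff_nth 4 0).
have hd k := eff_digit he (eff_const 4 k).
apply: eff_rat_add.
  apply: eff_rat_ext (eff_rat_frac (hd 1%N) (eff_const 4 0) (hd 2%N)) _ => v _.
  by rewrite subr0.
apply: eff_rat_mul.
  apply: eff_rat_max (eff_rat_nat (eff_const 4 0)) _; apply: eff_rat_of_code.
  exact: (eff_comp (gs := [:: _; _; _]) hD erefl (conj (hd 0%N)
    (conj (eff_behead (eff_nth 3 1)) (conj (eff_behead (eff_nth 3 2)) I)))).
apply: eff_rat_ext (eff_rat_frac (eff_const 4 1) (eff_const 4 0) (eff_const 4 B)) _.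
by move=> v _; rewrite subr0 mul1r.
Qed.

Section approximation.
Context {R : realType} {X : topologicalType} (P : polish_presentation R X).
Variables (B : nat) (D : nat -> nat -> nat -> nat).
Notation p := (pp_pt P).
Hypothesis DP : forall i j k,
  `|ratr (rat_of_code (D i j k)) - pp_dist P (p i) (p j)| < 2 ^- k.

Lemma gen_approxP s m k :
  `|ratr (gen_approx B D s m k) - gen_val P B s (p m)| <= 2 ^- k.
Proof.
rewrite ratr_minupto; apply: minupto_perturb => [|i]; first exact/ltW/half_pow_gt0.
have ratrE o y : ratr (o + y / B.+1%:R) = ratr o + ratr y / B.+1%:R :> R.
  by rewrite rmorphD /= fmorph_div /= ratr_nat.
rewrite ratrE; apply: scaled_perturb.
  exact/ltW/half_pow_gt0.
have := DP (digit (digit s i) 0) m k.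
have := pp_dist_ge0 P (p (digit (digit s i) 0)) (p m).
move: (pp_dist _ _ _) (rat_of_code _) => y q y0 /ltW.
rewrite maxEle; case: ifP => // /negbT; rewrite -ltNge -(ltrq0 R) => q0.
by rewrite rmorph0 !ler_norml; lra.
Qed.

Definition poly_approx n m j : R[i] := Complex
  (ratr (poly_part 0 (fun s => gen_approx B D s m j) n))
  (ratr (poly_part 1 (fun s => gen_approx B D s m j) n)).

Lemma poly_approxP n m k :
  cmod (poly_approx n m (k + poly_weight n) -
    rational_vector (gen P B) n (p m)) <= 2 ^- k.
Proof.
rewrite /poly_approx -peval_ratr /rational_vector starpoly_eval_gen.
apply: le_trans (nat_half_pow (poly_weight n) k).
apply: peval_code_perturb => [|s|s|s]; first exact/ltW/half_pow_gt0.
- have /andP[s0 s1] := gen_approx_01 B D s m (k + poly_weight n).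
  by rewrite ler0q s0 -[leRHS](ratr_nat R 1) ler_rat.
- exact: gen_val_01.
- exact: gen_approxP.
Qed.

End approximation.

Lemma eff_poly_approx B D k m a b c :
  effective 3 (fun v => D (nth 0%N v 0) (nth 0%N v 1) (nth 0%N v 2)) ->
  effective m a -> effective m b -> effective m c ->
  eff_rat m (fun v =>
    poly_part k (fun s => gen_approx B D s (b v) (c v)) (a v)).
Proof.
move=> hD ha hb hc.
have h := eff_poly_part k (eff_gen_approx B hD).
exact: (eff_rat_comp (gs := [:: a; b; c]) h erefl (conj ha (conj hb (conj hc I)))).
Qed.

Theorem theorem3p2 (R : realType) (X : topologicalType)
    (X_polish : polish R X) (X_compact : compact [set: X]%classic)
    (P : polish_presentation R X) (P_cc : computably_compact P) :
  exists A : CX_presentation R X,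
    [/\ computable_CX_presentation A,
        computable_maps (M := A) (N := complex_plane)
          (fun n => hat (pp_pt P n)) &
        computable_points (M := A) (fun n => dist_fun P (pp_pt P n))].
Proof.
case: P_cc => -[e_d e_dP] [tb /effective1 tb_eff tbP].
have [B hB] := pp_dist_bounded P X_compact.
have /choice[D' D'P] : forall jk : nat * nat, exists nu,
    is_name (M := @real_line R) (pp_dist P (pp_pt P jk.1) (pp_pt P jk.2)) nu /\
    forall i, runs no_oracle e_d [:: jk.1; jk.2; i] (nu i).
  by case=> j k; have [nu] := e_dP j k; exists nu.
pose D i j k := D' (i, j) k.
have hD : effective 3 (fun v => D (nth 0%N v 0) (nth 0%N v 1) (nth 0%N v 2)).
  by apply: (@effective3 D e_d) => i j k; exact: (D'P (i, j)).2.
have DP i j k :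
    `|ratr (rat_of_code (D i j k)) - pp_dist P (pp_pt P i) (pp_pt P j)| < 2 ^- k.
  exact: (D'P (i, j)).1.
pose A := @CXPresentation R X (gen P B) (fun f e e0 => gen_dense X_compact B f
  (ex_intro _ tb tbP) e0).
exists A; split.
- pose q v := poly_part 0 (fun s => gen_approx B D s (nth 0%N v 0)
      (nth 0%N v 2 + 2 + poly_weight (nth 0%N v 1))) (nth 0%N v 1) ^+ 2 +
    poly_part 1 (fun s => gen_approx B D s (nth 0%N v 0)
      (nth 0%N v 2 + 2 + poly_weight (nth 0%N v 1))) (nth 0%N v 1) ^+ 2.
  have hk : effective 3 (fun v => nth 0%N v 2 + 2)%N.
    exact: eff_add (eff_nth _ _) (eff_const _ _).
  have hq : eff_rat 3 q.
    have hj : effective 3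
        (fun v => nth 0%N v 2 + 2 + poly_weight (nth 0%N v 1))%N.
      by apply: eff_add hk _; exact/eff_poly_weight/eff_nth.
    have hp i := eff_poly_approx B i hD (eff_nth 3 1) (eff_nth 3 0) hj.
    exact: eff_rat_add (eff_rat_mul (hp 0%N) (hp 0%N)) (eff_rat_mul (hp 1%N) (hp 1%N)).
  have [N hN NP] := eff_rat_sqrt hq hk.
  pose net v := tb (nth 0%N v 1 + 2 + poly_weight (nth 0%N v 0))%N.
  have hnet : effective 2 net.
    apply: (eff_comp (gs := [:: fun v =>
      nth 0%N v 1 + 2 + poly_weight (nth 0%N v 0)])%N tb_eff erefl); split=> //.
    apply: eff_add (eff_poly_weight (eff_nth _ _)).
    exact: eff_add (eff_nth _ _) (eff_const _ _).
  pose F v := (\max_(i < net v) if odd (net v %/ 2 ^ i) then N [:: i : nat & v] else 0)%N.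
  have hF : effective 2 F.
    apply: (eff_max (F := fun i v =>
      if odd (net v %/ 2 ^ i) then N (i :: v) else 0)%N) => //.
    apply: eff_if (eff_const _ _).
      apply: eff_odd; apply: eff_div (eff_behead hnet) _.
      exact: eff_exp (eff_const _ _) (eff_nth _ _).
    by apply: eff_ext hN _ => -[|i v].
  have hG : effective 2 (fun v => CodeSeq.code [:: F v; 0%N; (2 ^ (nth 0%N v 1 + 2)).-1]).
    do !apply: eff_code_cons => //; do ?exact: eff_const.
    apply/eff_pred/(eff_exp (eff_const _ _)).
    exact: eff_add (eff_nth _ _) (eff_const _ _).
  have [e he] := hG; exists e => n.
  exists (fun k => CodeSeq.code [:: F [:: n; k]; 0%N; (2 ^ (k + 2)).-1]); last first.
    by move=> k; exact: (he no_oracle [:: n; k]).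
  move=> k.
  have codeE : ratr (rat_of_code
      (CodeSeq.code [:: F [:: n; k]; 0%N; (2 ^ (k + 2)).-1])) =
      (F [:: n; k])%:R / 2 ^+ (k + 2) :> R.
    rewrite /rat_of_code CodeSeq.codeK [nth _ _ 0]/= [nth _ _ 1]/= [nth _ _ 2]/=.
    by rewrite subr0 prednK ?expn_gt0 // fmorph_div /= !ratr_nat natrX.
  rewrite -[pm_dist _ _]/(`|ratr (rat_of_code _) - _|) {}codeE.
  set f := rational_vector (gen P B) n; set T := 2 ^+ (k + 2) : R.
  set w := poly_weight n.
  have T0 : 0 < T by rewrite exprn_gt0.
  pose z i := poly_approx (R := R) B D n i (k + 2 + w).
  have zP i : cmod (z i - f (pp_pt P i)) * T <= 1.
    by rewrite -ler_pdivlMr // div1r; exact: poly_approxP.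
  have NzP i : (N [:: i; n; k])%:R <= cmod (z i) * T < (N [:: i; n; k]).+1%:R.
    have q0 : 0 <= q [:: i; n; k] by rewrite addr_ge0 ?sqr_ge0.
    have := NP [:: i; n; k] erefl q0.
    have qE : ratr (q [:: i; n; k]) = cmod (z i) ^+ 2 :> R.
      by rewrite cmodE sqr_sqrtr ?addr_ge0 ?sqr_ge0 // rmorphD !rmorphXn.
    have qTE : ratr (q [:: i; n; k] * (2 ^+ (k + 2)) ^+ 2) =
        (cmod (z i) * T) ^+ 2 :> R.
      by rewrite rmorphM [X in X * _]qE !rmorphXn /= ratr_nat exprMn.
    rewrite -(ler_rat R) -(ltr_rat R) qTE !rmorphXn /= !ratr_nat.
    have zT0 : 0 <= cmod (z i) * T by rewrite mulr_ge0 ?cmod_ge0 // ltW.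
    by rewrite ler_sqr ?ltr_sqr ?nnegrE.
  have fN i : `|cmod (f (pp_pt P i)) * T - (N [:: i; n; k])%:R| <= 2.
    have := cmod_sub_le (z i) (f (pp_pt P i)).
    rewrite -(ler_pM2r T0) -{1}(gtr0_norm T0) -normrM mulrBl ler_norml.
    by have := zP i; have := NzP i; rewrite -natr1 ler_norml; lra.
  have S0 : 0 <= supnorm f.
    exact: le_trans (cmod_ge0 _) (supnorm_ub P X_compact f (pp_pt P 0)).
  have F_le : (F [:: n; k])%:R <= supnorm f * T + 2.
    rewrite /F; apply: (big_ind (fun m => m%:R <= supnorm f * T + 2)).
    - by rewrite addr_ge0 // mulr_ge0 // ltW.
    - by move=> x y hx hy; rewrite /maxn; case: ifP.
    move=> i _; case: ifP => _; last by rewrite addr_ge0 // mulr_ge0 // ltW.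
    have := fN i; have := supnorm_ub P X_compact f (pp_pt P i).
    by rewrite -(ler_pM2r T0) ler_norml; lra.
  have S_le : supnorm f <= ((F [:: n; k])%:R + 3) / T.
    apply: (supnorm_le P) => x; rewrite ler_pdivlMr //.
    have : (\bigcup_(i in coded_set (tb (k + 2 + w))) [set x |
        pm_dist (pm_pt P i) x < 2 ^- (k + 2 + w)]) x by rewrite -tbP.
    case=> i i_tb /= /ltW /(poly_lip B n); rewrite -/f -/w => ix.
    have lt_i : (i < net [:: n; k])%N.
      rewrite ltnNge; apply: contraPN i_tb => le_i; rewrite /coded_set /=.
      by rewrite divn_small // (leq_ltn_trans le_i) // ltn_expl.
    have NF : (N [:: i; n; k] <= F [:: n; k])%N.
      have := leq_bigmax (F := fun i : 'I_(net [:: n; k]) =>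
        if odd (net [:: n; k] %/ 2 ^ i) then N [:: i : nat; n; k] else 0%N)
        (Ordinal lt_i).
      by rewrite /= i_tb.
    have := cmod_sub_le (f (pp_pt P i)) (f x); rewrite ler_norml.
    have := le_trans ix (nat_half_pow w (k + 2)).
    rewrite -div1r ler_pdivlMr // -/T; have := fN i; rewrite ler_norml.
    move: NF; rewrite -(ler_nat R) => NF hfN hT /andP[/(ler_wpM2r (ltW T0))].
    by rewrite mulNr mulrBl => hfx _; lra.
  have -> : 2 ^- k = 4 / T.
    have -> : T = 4 * 2 ^+ k by rewrite /T exprD mulrC expr2 -natrM.
    by rewrite invfM mulVKf // pnatr_eq0.
  have S_ge : ((F [:: n; k])%:R - 2) / T <= supnorm f.
    by rewrite ler_pdivrMr // lerBlDr.
  have T40 : 0 < T^-1 by rewrite invr_gt0.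
  by rewrite ltr_norml; move: S_le S_ge; rewrite !mulrDl mulNr; lra.
- pose G i v := poly_part i (fun s => gen_approx B D s (nth 0%N v 1)
    (nth 0%N v 2 + 1 + poly_weight (nth 0%N v 0))) (nth 0%N v 0).
  have hG i : eff_rat 3 (G i).
    apply: (eff_poly_approx B i hD (eff_nth 3 0) (eff_nth 3 1)).
    apply: eff_add (eff_poly_weight (eff_nth _ _)).
    exact: eff_add (eff_nth _ _) (eff_const _ _).
  have [[F0 hF0 F0P] [F1 hF1 F1P]] := (hG 0%N, hG 1%N).
  have [e he] := eff_code_cons hF0 (eff_code_cons hF1 (eff_code_nil 3)).
  have [e1 he1] := eff_succ (eff_nth 2 1).
  exists (PComp e [:: PComp POracle [:: e1]; PProj 0; PProj 1]) => n f nu nuP.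
  exists (fun k => CodeSeq.code [:: F0 [:: nu k.+1; n; k]; F1 [:: nu k.+1; n; k]]).
    move=> k; set v := [:: _; _; _].
    have codeE : gaussr (gauss_of_code (CodeSeq.code [:: F0 v; F1 v])) =
        poly_approx B D (nu k.+1) n (k + 1 + poly_weight (nu k.+1)) :> R[i].
      by rewrite /gauss_of_code CodeSeq.codeK /gaussr /= -F0P // -F1P.
    rewrite -[pm_dist _ _]/(cmod (gaussr (gauss_of_code _) - f (pp_pt P n))) codeE.
    set g := rational_vector (gen P B) (nu k.+1).
    have le1 := poly_approxP B DP (nu k.+1) n (k + 1).
    have lt2 : cmod (g (pp_pt P n) - f (pp_pt P n)) < 2 ^- (k + 1).
      rewrite addn1; apply: le_lt_trans (nuP k.+1).
      exact: (supnorm_ub P X_compact (g - f)).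
    set z := poly_approx _ _ _ _ _ in le1 *.
    rewrite (_ : z - _ = (z - g (pp_pt P n)) + (g (pp_pt P n) - f (pp_pt P n)));
      last by rewrite addrA subrK.
    rewrite (le_lt_trans (cmodD _ _)) // (lt_le_trans (ler_ltD le1 lt2)) //.
    by rewrite addn1 exprS invfM; lra.
  move=> k /=; apply: (@runs_comp _ _ _ _ [:: nu k.+1; n; k]); last exact: he.
  apply: runs_cons; first apply: (@runs_comp _ _ _ _ [:: k.+1]).
  - by apply: runs_cons (runs_nil _ _); exact: (he1 nu [:: n; k]).
  - exact: (runs_oracle nu [:: k.+1]).
  apply: runs_cons; first exact: (runs_proj nu 0 [:: n; k]).
  by apply: runs_cons (runs_nil _ _); exact: (runs_proj nu 1 [:: n; k]).
have [c cE] := gauss_of_code_surj (Complex B.+1%:R 0).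
pose s n := CodeSeq.code [:: CodeSeq.code [:: n; 0%N; 0%N]].
pose F n := CodeSeq.code [:: CodeSeq.code [:: c; ((s n).*2)%N]].
have hF : effective 2 (fun v => F (nth 0%N v 0)).
  have hs : effective 2 (fun v => (s (nth 0%N v 0)).*2).
    have hs : effective 2 (fun v => s (nth 0%N v 0)).
      apply: eff_code_cons (eff_code_nil _).
      apply: eff_code_cons (eff_nth _ _) _; exact: eff_const.
    by apply: eff_ext (eff_mul (eff_const _ 2) hs) _ => v _; rewrite mul2n.
  apply: eff_code_cons (eff_code_nil _); apply: eff_code_cons (eff_const _ _) _.
  exact: eff_code_cons hs (eff_code_nil _).
have [e he] := hF; exists e => n; exists (fun=> F n); last first.
  by move=> k; exact: (he no_oracle [:: n; k]).
suff FE : rational_vector (gen P B) (F n) = dist_fun P (pp_pt P n).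
  move=> k; rewrite -[pm_dist _ _]/(supnorm (rational_vector (gen P B) (F n) - _)).
  rewrite FE subrr; apply: le_lt_trans (half_pow_gt0 k).
  by apply: (supnorm_le P) => x; rewrite [cmod _]cmod0.
apply: CX_eq => x.
have PE : starpoly_of_code (F n) = [:: (Complex B.+1%:R 0, [:: (s n, false)])].
  rewrite /starpoly_of_code CodeSeq.codeK.
  rewrite -[LHS]/[:: term_of_code (CodeSeq.code [:: c; (s n).*2])].
  rewrite /term_of_code CodeSeq.codeK.
  rewrite -[LHS]/[:: (gauss_of_code c, [:: letter_of_code (s n).*2])] cE.
  by rewrite /letter_of_code doubleK odd_double.
rewrite /rational_vector PE starpoly_eval_gen /peval !big_seq1 /gaussr.
rewrite [LHS]complexMr ratr_nat rmorph0 mul0r; congr Complex.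
have -> : gen_val P B (s n) x = pp_dist P (pp_pt P n) x / B.+1%:R.
  have entryE : digit (s n) 0 = CodeSeq.code [:: n; 0%N; 0%N].
    by rewrite /s CodeSeq.codeK.
  have offsetE : offset (digit (s n) 0) = 0.
    by rewrite entryE /offset CodeSeq.codeK mul0r.
  rewrite /gen_val digits_code -[LHS]/(Num.min 1 (ratr (offset (digit (s n) 0)) +
    pp_dist P (pp_pt P (digit (digit (s n) 0) 0)) x / B.+1%:R)).
  rewrite offsetE entryE CodeSeq.codeK rmorph0 add0r; apply/min_idPr.
  by rewrite ler_pdivrMr ?ltr0Sn // mul1r.
by rewrite mulrC divfK // pnatr_eq0.
Qed.
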